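(* Let $X$ be a compact Hausdorff space. Every countably generated Hilbert $C^*$-module over $C(X)$ is $C^*$-reflexive if and only if there does not exist a sequence $\{I_k\}_{k\in\mathbb N}$ of non-zero, pairwise orthogonal closed ideals of $C(X)$ such that $\prod_k I_k$ is canonically included into $C(X)$.
   Context: For a Hilbert $C^*$-module $M$ over a $C^*$-algebra $A$, $M'$ denotes the module of bounded $A$-module maps $M\to A$ and $M''=(M')'$ (Paschke's conventions); there is a canonical isometric inclusion $M\subseteq M''$, and $M$ is called $C^*$-reflexive if $M''=M$. Closed ideals of $C(X)$ are of the form $C_0(U)=\{f\in C(X): f=0 \text{ on } X\setminus U\}$ with $U\subseteq X$ open; ideals $I_k=C_0(U_k)$ are pairwise orthogonal if $I_kI_l=0$ for $k\ne l$, i.e. the $U_k$ are pairwise disjoint. $\prod_k I_k$ is the $C^*$-algebra of bounded sequences $(\lambda_k)$, $\lambda_k\in I_k$, with sup norm. It is canonically included into $C(X)$ if the canonical inclusion $\bigoplus_k I_k\subseteq C(X)$ extends to an inclusion of $\prod_k I_k$, i.e. for every bounded sequence $(\lambda_k)$, $\lambda_k\in C_0(U_k)$, there is a (necessarily unique) continuous function on $X$ equal to $\lambda_k$ on each $U_k$ and vanishing on $X\setminus\overline{\bigcup_kU_k}$. *)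

(* Defs.v *)
From mathcomp Require Import all_boot all_order all_algebra.
From mathcomp Require Import all_classical all_reals topology normedtype.
From mathcomp Require Import complex.

Set Implicit Arguments.
Unset Strict Implicit.
Unset Printing Implicit Defensive.

Import Order.TTheory GRing.Theory Num.Theory.
Import numFieldNormedType.Exports.
Local Open Scope ring_scope.
Local Open Scope classical_set_scope.

(* Scalars: the complex numbers R[i] over an arbitrary real field R : realType.
   The commutative C*-algebra C(X) is represented by the continuous functions
   X -> R[i] (a function is continuous iff its real and imaginary parts are). *)

Section HilbertModules.
Variables (R : realType) (X : topologicalType).
Local Notation C := (complex R).

(* f is an element of C(X) *)
Definition ccont (f : X -> C) : Prop :=
  continuous (fun t => (complex.Re (f t) : R^o)) /\ continuous (fun t => (complex.Im (f t) : R^o)).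

(* |z|^2 *)
Definition csq (z : C) : R := complex.Re z ^+ 2 + complex.Im z ^+ 2.

(* The constant function 1 of C(X). *)
Definition cone : X -> C := fun _ => 1.

(* A (right) Hilbert C*-module over C(X): a right C(X)-module M with a
   C(X)-valued inner product <.,.>, linear in the second variable,
   <y,x> = <x,y>^*, <x,x> >= 0, <x,x> = 0 -> x = 0, complete for the norm
   ||x|| = || <x,x> ||_oo ^(1/2). *)
Record hmod := HMod {
  hcar :> zmodType;
  hact : hcar -> (X -> C) -> hcar;             (* x . a *)
  hip  : hcar -> hcar -> X -> C;               (* <x, y> *)
  hact_addl : forall (x y : hcar) a, ccont a -> hact (x + y) a = hact x a + hact y a;
  hact_addr : forall (x : hcar) a b, ccont a -> ccont b ->
                hact x (fun t => a t + b t) = hact x a + hact x b;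
  hact_mul  : forall (x : hcar) a b, ccont a -> ccont b ->
                hact x (fun t => a t * b t) = hact (hact x a) b;
  hact_one  : forall x : hcar, hact x cone = x;
  hip_cont  : forall x y : hcar, ccont (hip x y);
  hip_addr  : forall (x y z : hcar) t, hip x (y + z) t = hip x y t + hip x z t;
  hip_actr  : forall (x y : hcar) a t, ccont a -> hip x (hact y a) t = hip x y t * a t;
  hip_conj  : forall (x y : hcar) t, hip y x t = ((hip x y t)^*)%C;
  hip_pos   : forall (x : hcar) t, 0 <= hip x x t;
  hip_def   : forall x : hcar, (forall t, hip x x t = 0) -> x = 0;
  (* completeness: every Cauchy sequence converges *)
  hcomplete : forall u : nat -> hcar,
     (forall e : R, 0 < e -> exists N, forall m n, (N <= m)%N -> (N <= n)%N ->
         forall t, complex.Re (hip (u m - u n) (u m - u n) t) <= e) ->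
     exists x : hcar, forall e : R, 0 < e -> exists N, forall n, (N <= n)%N ->
         forall t, complex.Re (hip (u n - x) (u n - x) t) <= e
}.

Variable M : hmod.

(* ||x||^2 <= c *)
Definition nle (x : M) (c : R) : Prop :=
  forall t, complex.Re (hip x x t) <= c.

(* M is countably generated: the C(X)-linear span of a sequence is dense. *)
Definition countably_generated : Prop :=
  exists g : nat -> M, forall (x : M) (e : R), 0 < e ->
    exists (n : nat) (a : nat -> X -> C), (forall i, ccont (a i)) /\
      nle (x - \sum_(i < n) hact (g i) (a i)) e.

(* ||T||^2 <= K as an operator M -> C(X) *)
Definition opnle (T : M -> X -> C) (K : R) : Prop :=
  forall (x : M) (c : R), nle x c -> forall t, csq (T x t) <= K * c.

(* T is an element of M' : a bounded C(X)-module map M -> C(X). *)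
Definition in_dual (T : M -> X -> C) : Prop :=
  [/\ forall x, ccont (T x),
      forall (x y : M) t, T (x + y) t = T x t + T y t,
      forall (x : M) a t, ccont a -> T (hact x a) t = T x t * a t
    & exists K : R, opnle T K].

(* Right C(X)-module structure on M' (Paschke): (T.a)(x) = a^* T(x). *)
Definition dual_act (T : M -> X -> C) (a : X -> C) : M -> X -> C :=
  fun x t => ((a t)^*)%C * T x t.

Definition dual_add (T S : M -> X -> C) : M -> X -> C :=
  fun x t => T x t + S x t.

(* phi is an element of M'' : a bounded C(X)-module map M' -> C(X). *)
Definition in_bidual (phi : (M -> X -> C) -> X -> C) : Prop :=
  [/\ forall T, in_dual T -> ccont (phi T),
      forall T S t, in_dual T -> in_dual S -> phi (dual_add T S) t = phi T t + phi S t,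
      forall T a t, in_dual T -> ccont a -> phi (dual_act T a) t = phi T t * a t
    & exists K : R, forall T c, in_dual T -> opnle T c ->
         forall t, csq (phi T t) <= K * c].

(* Canonical inclusion M -> M'' : x |-> (T |-> T(x)^* ). *)
Definition canon_bidual (x : M) : (M -> X -> C) -> X -> C :=
  fun T t => ((T x t)^*)%C.

(* M is C*-reflexive: the canonical inclusion M -> M'' is onto. *)
Definition cstar_reflexive : Prop :=
  forall phi, in_bidual phi ->
    exists x : M, forall T, in_dual T -> forall t, phi T t = canon_bidual x T t.

End HilbertModules.

Section Ideals.
Variables (R : realType) (X : topologicalType).
Local Notation C := (complex R).

(* Closed (two-sided) ideal of C(X). *)
Definition closed_ideal (I : set (X -> C)) : Prop :=
  [/\ forall f, I f -> ccont f,
      I (fun _ => 0),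
      forall f g, I f -> I g -> I (fun t => f t + g t),
      forall f a, I f -> ccont a -> I (fun t => f t * a t)
    & forall (u : nat -> X -> C) f, (forall n, I (u n)) -> ccont f ->
        (forall e : R, 0 < e -> exists N, forall n, (N <= n)%N ->
           forall t, csq (u n t - f t) <= e) -> I f].

Definition nonzero_ideal (I : set (X -> C)) : Prop :=
  exists f, I f /\ exists t, f t <> 0.

Definition orthogonal_ideals (I J : set (X -> C)) : Prop :=
  forall f g, I f -> J g -> forall t, f t * g t = 0.

(* The open set U with I = C_0(U). *)
Definition ideal_support (I : set (X -> C)) : set X :=
  [set t | exists f, I f /\ f t <> 0].

(* prod_k I_k is canonically included into C(X). *)
Definition prod_canon_included (I : nat -> set (X -> C)) : Prop :=
  forall lam : nat -> X -> C, (forall k, I k (lam k)) ->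
    (exists B : R, forall k t, csq (lam k t) <= B) ->
    exists f : X -> C, [/\ ccont f,
       forall k t, ideal_support (I k) t -> f t = lam k t
     & forall t, ~ closure (\bigcup_k ideal_support (I k)) t -> f t = 0].

End Ideals.

(* Main.v *)
Require Import Defs.
From HB Require Import structures.
From mathcomp Require Import all_boot all_order all_algebra.
From mathcomp Require Import all_classical all_reals topology normedtype.
From mathcomp Require Import complex ring lra.

(** For x in M put |x|^2 = <x,x>, a function on X; a functional T in M' is a field
    of functionals on the fibres of M whose norm is lower semicontinuous in the
    point.  Hence, near some points of any open set, T is uniformly close to <x,.>
    for some x in M, and every phi in M'' is controlled there by its restriction
    F y = phi(<y,.>) to M.  This makes |phi - x|^2 = phi(F) - 2 Re F(x) + |x|^2 a
    nonnegative continuous function.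

    If the infimum over x of |phi - x|^2 vanishes at every point, a partition of
    unity and completeness give phi in M.  Otherwise it is positive at some t0.  A
    vector y almost closest to phi at t0, and vectors x very close to phi on small
    open sets V_k near t0, produce z_k = x - y such that on V_k the vector z_k is
    bounded, almost orthogonal to the first k generators of M, and F(z_k) is
    bounded away from 0; the V_k can be made disjoint.  For bounded lam_k in
    C_0(V_k) the sum T of the <z_k lam_k / F(z_k), .> is then in M', and phi(T) is
    the required extension of (lam_k).

    Conversely, given the ideals I_k, choose g_k in I_k with values of modulus at
    most 1 attaining 1.  The ideal C_0(U), where U is the union of the open sets
    g_k <> 0, is countably generated.  Sending T to the extension of the sequence
    (T(g_k)^* ) defines an element of its bidual which could only come from the
    sum of the g_k, and this sum is not in C_0(U) by compactness of X. *)

Set Implicit Arguments.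
Unset Strict Implicit.
Unset Printing Implicit Defensive.

Import Order.TTheory GRing.Theory Num.Theory.
Import numFieldNormedType.Exports.
Local Open Scope ring_scope.
Local Open Scope classical_set_scope.

Local Notation Re := complex.Re.
Local Notation Im := complex.Im.

(** * Complex scalars and continuous functions *)

Section ComplexScalars.
Variable R : realType.
Implicit Types (z w l c : complex R) (r s q eta : R).

Lemma eq_complexP z w : Re z = Re w -> Im z = Im w -> z = w.
Proof. by case: z w => [a b] [a' b'] /= -> ->. Qed.

Lemma cReD z w : Re (z + w) = Re z + Re w. Proof. by case: z; case: w. Qed.
Lemma cImD z w : Im (z + w) = Im z + Im w. Proof. by case: z; case: w. Qed.
Lemma cReN z : Re (- z) = - Re z. Proof. by case: z. Qed.
Lemma cImN z : Im (- z) = - Im z. Proof. by case: z. Qed.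
Lemma cReB z w : Re (z - w) = Re z - Re w. Proof. by rewrite cReD cReN. Qed.
Lemma cImB z w : Im (z - w) = Im z - Im w. Proof. by rewrite cImD cImN. Qed.
Lemma cReM z w : Re (z * w) = Re z * Re w - Im z * Im w.
Proof. by case: z; case: w. Qed.
Lemma cImM z w : Im (z * w) = Re z * Im w + Im z * Re w.
Proof. by case: z; case: w. Qed.
Lemma cReJ z : Re (z^*)%C = Re z. Proof. by case: z. Qed.
Lemma cImJ z : Im (z^*)%C = - Im z. Proof. by case: z. Qed.
Lemma cReC r : Re (r%:C)%C = r. Proof. by []. Qed.
Lemma cImC r : Im (r%:C)%C = 0. Proof. by []. Qed.

Definition ReImE := (cReB, cImB, cReD, cImD, cReN, cImN, cReM, cImM, cReJ, cImJ, cReC, cImC).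

Lemma csq_ge0 z : 0 <= csq z. Proof. by rewrite addr_ge0 ?sqr_ge0. Qed.
Lemma csq0 : csq (0 : complex R) = 0. Proof. by rewrite /csq /=; ring. Qed.
Lemma csqM z w : csq (z * w) = csq z * csq w.
Proof. by rewrite /csq !ReImE; ring. Qed.
Lemma csqJ z : csq (z^*)%C = csq z. Proof. by rewrite /csq !ReImE sqrrN. Qed.
Lemma csqN z : csq (- z) = csq z. Proof. by rewrite /csq !ReImE !sqrrN. Qed.
Lemma csqC r : csq (r%:C)%C = r ^+ 2. Proof. by rewrite /csq !ReImE; ring. Qed.
Lemma csqD z w : csq (z + w) <= 2 * csq z + 2 * csq w.
Proof.
rewrite /csq !ReImE.
have := sqr_ge0 (Re z - Re w); have := sqr_ge0 (Im z - Im w); nra.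
Qed.

Lemma csqB z w : csq (z - w) <= 2 * csq z + 2 * csq w.
Proof. by rewrite -(csqN w) csqD. Qed.
Lemma Re_sq_le z : Re z ^+ 2 <= csq z. Proof. by rewrite lerDl sqr_ge0. Qed.
Lemma Im_sq_le z : Im z ^+ 2 <= csq z. Proof. by rewrite lerDr sqr_ge0. Qed.
(** The arithmetic-geometric mean inequality [2 |z| <= r + s], in a form free of square roots. *)
Lemma Re_le_mean z (r s : R) : 0 <= r -> 0 <= s -> csq z <= r * s ->
  2 * Re z <= r + s.
Proof.
move=> r0 s0 h; have {}h := le_trans (Re_sq_le z) h.
rewrite leNgt; apply/negP => rs.
have : 0 < (2 * Re z - (r + s)) * (2 * Re z + (r + s)).
  by apply: mulr_gt0; lra.
have := sqr_ge0 (r - s); nra.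
Qed.

Lemma sq_le_bound (r s : R) : 0 <= s -> r ^+ 2 <= s ^+ 2 -> - s <= r <= s.
Proof. by move=> s0 h; apply/andP; split; nra. Qed.
Lemma csq_le0 z : csq z <= 0 -> z = 0.
Proof.
move=> z0; have h := csq_ge0 z.
have r0 : Re z ^+ 2 == 0.
  by rewrite eq_le sqr_ge0 andbT (le_trans (Re_sq_le z)).
have i0 : Im z ^+ 2 == 0.
  by rewrite eq_le sqr_ge0 andbT (le_trans (Im_sq_le z)).
by apply: eq_complexP; apply/eqP; rewrite -sqrf_eq0.
Qed.

Lemma csq_gt0 z : z <> 0 -> 0 < csq z.
Proof. by move=> z0; rewrite ltNge; apply/negP => /csq_le0. Qed.
Lemma mulJc z : (z^*)%C * z = ((csq z)%:C)%C.
Proof. by apply: eq_complexP; rewrite /csq !ReImE; ring. Qed.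
Lemma csq_eq z w : (forall e, 0 < e -> csq (z - w) <= e) -> z = w.
Proof.
move=> h; apply/eqP; rewrite -subr_eq0; apply/eqP/csq_le0.
by apply/ler_addgt0Pr => e /h; rewrite add0r.
Qed.

(* Both the Cauchy-Schwarz inequality and the near-orthogonality of the error
   of an almost optimal approximation are obtained by feeding a variational
   inequality to this lemma. *)
Lemma csq_le_variation c q eta : 0 <= q ->
  (forall l, 2 * Re (l * c) - csq l * q <= eta) -> csq c <= eta * q.
Proof.
move=> q0 h; have h0 := csq_ge0 c.
(* Taking [l] to be a real multiple of the conjugate of [c] makes [l * c] real and leaves a
   quadratic in [r], maximal at [1/q] when [q > 0]. *)
have key r : 2 * (r * csq c) - r ^+ 2 * csq c * q <= eta.
  have := h ((c^*)%C * (r%:C)%C); rewrite csqM csqJ csqC.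
  suff -> : Re ((c^*)%C * (r%:C)%C * c) = r * csq c by rewrite (mulrC (csq c)).
  by rewrite /csq !ReImE; ring.
have [q0'|q0'] := ltrP 0 q.
  have := key q^-1; have -> : 2 * (q^-1 * csq c) - q^-1 ^+ 2 * csq c * q = csq c / q.
    by field; rewrite gt_eqF.
  by rewrite ler_pdivrMr.
have q00 : q = 0 by apply/eqP; rewrite eq_le q0 q0'.
rewrite {q0 q0' h}q00 in key *.
rewrite mulr0 leNgt; apply/negP => c0.
(* For [q = 0] the bound is linear in [r], and this [r] violates it. *)
have := key ((eta + 1) / csq c); rewrite mulr0 subr0 divfK ?gt_eqF //.
have := key 0; rewrite !mul0r expr0n /=; lra.
Qed.

End ComplexScalars.

Lemma inv_succ_le (R : realType) (e : R) : 0 < e ->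
  exists N : nat, forall k, (N <= k)%N -> k.+1%:R^-1 <= e.
Proof.
move=> e0; have [N _ hN] : \forall k \near \oo, e^-1 < k%:R :> R.
  exact: nbhs_infty_gtr.
exists N => k Nk; rewrite -[e]invrK lef_pV2 ?posrE ?invr_gt0 ?ltr0n //.
by apply/ltW/hN => /=; apply: leq_trans (leqnSn k).
Qed.

(** * Algebra and uniform limits of continuous functions *)

Section Continuity.
Variables (R : realType) (X : topologicalType).
Local Notation C := (complex R).
Definition rcont (f : X -> R) : Prop := continuous (f : X -> R^o).
Implicit Types (f g : X -> R) (a b : X -> C).

Lemma rcontC (c : R) : rcont (fun _ => c).
Proof. by move=> x; exact: cvg_cst. Qed.
Lemma rcontD f g : rcont f -> rcont g -> rcont (fun t => f t + g t).
Proof. by move=> cf cg x; apply: continuousD; [exact: cf|exact: cg]. Qed.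
Lemma rcontN f : rcont f -> rcont (fun t => - f t).
Proof. by move=> cf x; apply: continuousN; exact: cf. Qed.
Lemma rcontB f g : rcont f -> rcont g -> rcont (fun t => f t - g t).
Proof. by move=> cf cg; apply: rcontD => //; exact: rcontN. Qed.
Lemma rcontM f g : rcont f -> rcont g -> rcont (fun t => f t * g t).
Proof. by move=> cf cg x; apply: (@continuousM R); [exact: cf|exact: cg]. Qed.
Lemma rcontX2 f : rcont f -> rcont (fun t => f t ^+ 2).
Proof. by move=> cf; apply: (rcontM cf). Qed.
Lemma rcont_max f g : rcont f -> rcont g -> rcont (fun t => Num.max (f t) (g t)).
Proof. by move=> cf cg x; apply: continuous_max; [exact: cf|exact: cg]. Qed.
Lemma rcontV f : (forall t, f t != 0) -> rcont f -> rcont (fun t => (f t)^-1).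
Proof. by move=> f0 cf x; apply: (@continuousV R) => //; exact: cf. Qed.

Lemma rcont_near_gt f (r : R) t : rcont f -> r < f t -> \forall s \near t, r < f s.
Proof. by move=> /(_ t) cf h; exact: (cvgr_gt (f t)). Qed.
Lemma rcont_near_lt f (r : R) t : rcont f -> f t < r -> \forall s \near t, f s < r.
Proof. by move=> /(_ t) cf h; exact: (cvgr_lt (f t)). Qed.
Lemma rcont_open_gt f (r : R) : rcont f -> open [set t | r < f t].
Proof. by move=> cf; rewrite openE => t /= h; exact: (rcont_near_gt cf h). Qed.
Lemma rcont_open_lt f (r : R) : rcont f -> open [set t | f t < r].
Proof. by move=> cf; rewrite openE => t /= h; exact: (rcont_near_lt cf h). Qed.

Lemma ccont_cst (c : C) : ccont (fun _ : X => c).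
Proof. by split; exact: rcontC. Qed.
Lemma ccontD a b : ccont a -> ccont b -> ccont (fun t => a t + b t).
Proof.
move=> [ra ia] [rb ib]; split.
  by under [fun t => _]eq_fun do rewrite cReD; exact: rcontD.
by under [fun t => _]eq_fun do rewrite cImD; exact: rcontD.
Qed.

Lemma ccontN a : ccont a -> ccont (fun t => - a t).
Proof.
move=> [ra ia]; split.
  by under [fun t => _]eq_fun do rewrite cReN; exact: rcontN.
by under [fun t => _]eq_fun do rewrite cImN; exact: rcontN.
Qed.

Lemma ccontB a b : ccont a -> ccont b -> ccont (fun t => a t - b t).
Proof. by move=> ca cb; apply: ccontD => //; exact: ccontN. Qed.
Lemma ccontM a b : ccont a -> ccont b -> ccont (fun t => a t * b t).
Proof.
move=> [ra ia] [rb ib]; split.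
  by under [fun t => _]eq_fun do rewrite cReM; apply: rcontB; exact: rcontM.
by under [fun t => _]eq_fun do rewrite cImM; apply: rcontD; exact: rcontM.
Qed.

Lemma ccontJ a : ccont a -> ccont (fun t => (a t)^*)%C.
Proof.
move=> [ra ia]; split; first by under [fun t => _]eq_fun do rewrite cReJ.
by under [fun t => _]eq_fun do rewrite cImJ; exact: rcontN.
Qed.

Lemma ccontC f : rcont f -> ccont (fun t => ((f t)%:C)%C).
Proof. by split=> //; exact: rcontC. Qed.
Lemma rcont_csq a : ccont a -> rcont (fun t => csq (a t)).
Proof. by move=> [ra ia]; apply: rcontD; exact: rcontX2. Qed.

Lemma rcont_uniform_limit f :
  (forall e : R, 0 < e -> exists2 g, rcont g & forall t, `|f t - g t| <= e) ->
  rcont f.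
Proof.
move=> h t; apply/cvgrPdist_lt => e e0.
have e4 : 0 < e / 4 by lra.
have [g cg fg] := h _ e4.
have /cvgrPdist_lt/(_ _ e4) := cg t.
apply: filterS => s gs.
have := fg t; have := fg s; rewrite !ler_norml => /andP[? ?] /andP[? ?].
move: gs; rewrite !ltr_norml => /andP[? ?]; apply/andP; split; lra.
Qed.

Lemma ccont_uniform_limit a :
  (forall e : R, 0 < e -> exists2 b, ccont b & forall t, csq (a t - b t) <= e) ->
  ccont a.
Proof.
have sq (r e : R) : 0 < e -> r ^+ 2 <= e ^+ 2 -> `|r| <= e.
  by move=> e0 h; rewrite ler_norml; apply/andP; split; nra.
move=> h; split; apply: rcont_uniform_limit => e e0;
  have [|b [rb ib] ab] := h (e ^+ 2); rewrite ?exprn_gt0 //.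
  exists (fun t => Re (b t)) => // t; apply: sq => //.
  by rewrite -cReB; apply: le_trans (ab t); exact: Re_sq_le.
exists (fun t => Im (b t)) => // t; apply: sq => //.
by rewrite -cImB; apply: le_trans (ab t); exact: Im_sq_le.
Qed.

(** * Bump functions and compactness arguments *)

Section Compact.
Hypotheses (hX : hausdorff_space X) (cX : compact [set: X]).

(** A compact Hausdorff space is normal, hence completely regular. These bumps localise functionals
    around a point. *)
Lemma urysohn_bump (V : set X) t : open V -> V t ->
  exists b : X -> R, [/\ rcont b, forall s, 0 <= b s <= 1, b t = 1 &
    forall s, ~ V s -> b s = 0].
Proof.
move=> oV Vt.
have := @normal_completely_regular R X (compact_normal hX cX)
  (hausdorff_accessible hX) t (~` V) (open_closedC oV) (fun h => h Vt).
move=> /(@uniform_separatorP _ R)[f [cf f01 f0 f1]].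
exists (fun s => 1 - f s); split.
- by apply: rcontB => //; exact: rcontC.
- move=> s; have /f01 : range f (f s) by exists s.
  by rewrite /= in_itv /= => /andP[? ?]; apply/andP; split; lra.
- by have -> : f t = 0 by [apply: f0; exists t]; rewrite subr0.
- by move=> s Vs; have -> : f s = 1 by [apply: f1; exists s]; rewrite subrr.
Qed.

(** Each point has a neighbourhood on which [P k] holds from some threshold on; finitely many of
    them cover [X], and the largest threshold serves everywhere. *)
Lemma compact_exhaust (P : nat -> X -> Prop) :
  (forall t : X, \forall s \near t & k \near \oo, P k s) -> exists k, forall t, P k t.
Proof.
move=> h; have /compact_near_coveringP/(_ nat \oo P _) := cX.
case=> // k0 _ /(_ k0 (leqnn _)) hk; exists k0 => t; exact: hk.
Qed.

Lemma finite_subcover (U : X -> set X) :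
  (forall t, open (U t)) -> (forall t, U t t) ->
  exists l : seq X, forall s, exists2 t, t \in l & U t s.
Proof.
move=> oU Ut.
(* Filter of the properties that hold for all sufficiently large finite lists; the near-covering
   form of compactness then produces a single list. *)
pose F : set_system (seq X) :=
  [set S | exists l0 : seq X, forall l : seq X, {subset l0 <= l} -> S l].
have FF : Filter F.
  split; first by exists [::].
    move=> S S' [l hl] [l' hl']; exists (l ++ l') => m lm; split.
      by apply: hl => t tl; apply: lm; rewrite mem_cat tl.
    by apply: hl' => t tl; apply: lm; rewrite mem_cat tl orbT.
  by move=> S S' SS' [l hl]; exists l => m /hl; exact: SS'.
have /compact_near_coveringP/(_ _ F (fun (l : seq X) s => exists2 t, t \in l & U t s) FF) := cX.
case=> [t _|l /(_ l (fun _ h => h)) hl]; last by exists l => s; exact: hl.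
exists (U t, [set l : seq X | t \in l]); first split => /=.
- by apply: open_nbhs_nbhs.
- by exists [:: t] => l; apply; rewrite mem_head.
- by move=> [s l] /= [Us tl]; exists t.
Qed.

Lemma rcont_bounded f : rcont f -> exists B : R, forall t, f t <= B.
Proof.
move=> cf; have [t|k hk] := @compact_exhaust (fun k t => f t <= k%:R).
  have [k0 _ hk0] : \forall k \near \oo, f t < k%:R :> R by exact: nbhs_infty_gtr.
  have ht : f t < k0%:R by apply: hk0 => /=.
  exists ([set s | f s < k0%:R], [set k | (k0 <= k)%N]).
    split; [exact: (rcont_near_lt cf ht)|by exists k0].
  move=> [s k] /= [fs kk]; apply: (le_trans (ltW fs)); by rewrite ler_nat.
by exists k%:R.
Qed.

Lemma csq_bounded a : ccont a -> exists2 B : R, 0 <= B & forall t, csq (a t) <= B.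
Proof.
move=> /rcont_csq /rcont_bounded[B hB]; exists (Num.max B 0).
  by rewrite le_max lexx orbT.
by move=> t; rewrite le_max hB.
Qed.

End Compact.
End Continuity.

(** * Hilbert modules and their duals *)

Section HilbertModule.
Variables (R : realType) (X : topologicalType) (M : hmod R X).
Local Notation C := (complex R).
Implicit Types (x y z : M) (t : X) (a : X -> C) (T S : M -> X -> C) (K : R).

Definition hsq x t : R := Re (hip x x t).

Lemma hip_addl x y z t : hip (x + y) z t = hip x z t + hip y z t.
Proof. by rewrite hip_conj hip_addr rmorphD /= -!hip_conj. Qed.
Lemma hip_actl x y a t : ccont a -> hip (hact x a) y t = (a t)^*%C * hip x y t.
Proof. by move=> ca; rewrite hip_conj hip_actr // rmorphM /= -hip_conj mulrC. Qed.
Lemma hip0r x t : hip x 0 t = 0.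
Proof. by apply: (addrI (hip x 0 t)); rewrite -hip_addr !addr0. Qed.
Lemma hip0l x t : hip 0 x t = 0.
Proof. by rewrite hip_conj hip0r conjc0. Qed.
Lemma hipNr x y t : hip x (- y) t = - hip x y t.
Proof. by apply: (addrI (hip x y t)); rewrite -hip_addr !subrr hip0r. Qed.
Lemma hipNl x y t : hip (- x) y t = - hip x y t.
Proof. by apply: (addrI (hip x y t)); rewrite -hip_addl !subrr hip0l. Qed.
Lemma hipBl x y z t : hip (x - y) z t = hip x z t - hip y z t.
Proof. by rewrite hip_addl hipNl. Qed.

Lemma hsq_ge0 x t : 0 <= hsq x t.
Proof.
by have := hip_pos x t; rewrite /hsq lecE; case: (hip x x t) => a b /= /andP[].
Qed.

Lemma hip_xx x t : hip x x t = ((hsq x t)%:C)%C.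
Proof.
apply: eq_complexP => //=; have := hip_pos x t.
by rewrite lecE => /andP[/eqP].
Qed.

Lemma hsqD x y t : hsq (x + y) t = hsq x t + 2 * Re (hip x y t) + hsq y t.
Proof.
rewrite /hsq !(hip_addl, hip_addr) !cReD (hip_conj x y t) cReJ; ring.
Qed.

Lemma hsqN x t : hsq (- x) t = hsq x t.
Proof. by rewrite /hsq hipNl hipNr opprK. Qed.
Lemma hsqB x y t : hsq (x - y) t = hsq x t - 2 * Re (hip x y t) + hsq y t.
Proof. by rewrite hsqD hsqN hipNr cReN; ring. Qed.
Lemma hsq_act x a t : ccont a -> hsq (hact x a) t = csq (a t) * hsq x t.
Proof.
by move=> ca; rewrite /hsq hip_actl // hip_actr // hip_xx /csq !ReImE; ring.
Qed.

Lemma hsq0 t : hsq 0 t = 0. Proof. by rewrite /hsq hip0r. Qed.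
Lemma rcont_hsq x : rcont (hsq x).
Proof. by have [] := hip_cont x x. Qed.

Lemma hip_cauchy_schwarz x y t : csq (hip x y t) <= hsq x t * hsq y t.
Proof.
apply: csq_le_variation; first exact: hsq_ge0.
move=> l; have := hsq_ge0 (x - hact y (fun _ => l)) t.
rewrite hsqB hsq_act ?hip_actr; try exact: ccont_cst.
by rewrite (mulrC _ l); lra.
Qed.

Lemma dual0 T t : in_dual T -> T 0 t = 0.
Proof. by move=> [_ TD _ _]; apply: (addrI (T 0 t)); rewrite -TD !addr0. Qed.
Lemma dualN T x t : in_dual T -> T (- x) t = - T x t.
Proof.
move=> dT; have [_ TD _ _] := dT.
by apply: (addrI (T x t)); rewrite -TD !subrr dual0.
Qed.

Lemma dualB T x y t : in_dual T -> T (x - y) t = T x t - T y t.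
Proof. by move=> dT; have [_ TD _ _] := dT; rewrite TD dualN. Qed.

Lemma opnle_ge0 T K t : in_dual T -> opnle T K -> 0 <= K.
Proof.
move=> dT /(_ 0 1) h; have := h _ t; rewrite dual0 // csq0 mulr1; apply.
by move=> s; rewrite hip0r ler01.
Qed.

(* Truncate [x] to [x c / max(<x,x>, c)], which is [x] at [t] and of norm at most
   [c] everywhere. *)
Lemma dual_pointwise T K x t : in_dual T -> opnle T K ->
  csq (T x t) <= K * hsq x t.
Proof.
move=> dT TK; have K0 := opnle_ge0 t dT TK.
have key (c : R) : hsq x t < c -> csq (T x t) <= K * c.
  move=> xc; have c0 : 0 < c by apply: le_lt_trans xc; exact: hsq_ge0.
  pose m s := Num.max (hsq x s) c.
  have m0 s : 0 < m s by rewrite lt_max c0 orbT.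
  have cm : rcont m.
    by apply: rcont_max; [exact: rcont_hsq|exact: rcontC].
  pose a s : C := ((c / m s)%:C)%C.
  have ca : ccont a.
    apply: ccontC; apply: rcontM; first exact: rcontC.
    by apply: rcontV => // s; rewrite gt_eqF.
  have -> : T x t = T (hact x a) t.
    have [_ _ Ta _] := dT; rewrite Ta // /a /m max_r ?ltW // divff ?gt_eqF //.
    by rewrite mulr1.
  apply: TK => s; rewrite -/(hsq _ s) hsq_act // csqC.
  have ms : hsq x s <= m s by rewrite le_max lexx.
  have mc : c <= m s by rewrite le_max lexx orbT.
  rewrite expr_div_n mulrAC ler_pdivrMr ?exprn_gt0 // expr2 -mulrA.
  apply: ler_wpM2l; first exact: ltW.
  by rewrite expr2; apply: ler_pM => //; [exact: ltW|exact: hsq_ge0].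
(* Let [c] decrease to [hsq x t]; dividing by [K + 1] allows [K = 0]. *)
apply/ler_addgt0Pr => e e0; have K1 : 0 < K + 1 by lra.
have := key (hsq x t + e / (K + 1)); rewrite ltrDl divr_gt0 // => /(_ isT) h.
apply: (le_trans h); rewrite mulrDr lerD2l mulrA ler_pdivrMr //.
by rewrite mulrDr mulr1 mulrC lerDl ltW.
Qed.

Lemma opnleI T K : 0 <= K -> (forall x t, csq (T x t) <= K * hsq x t) -> opnle T K.
Proof. by move=> K0 h x c xc t; apply: (le_trans (h x t)); exact: (ler_wpM2l K0 (xc t)). Qed.

(** Over an empty space the constant of [in_dual] may be negative, hence the maximum with 0. *)
Lemma in_dual_bound T : in_dual T ->
  exists2 K : R, 0 <= K & forall x t, csq (T x t) <= K * hsq x t.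
Proof.
move=> dT; have [_ _ _ [K TK]] := dT; exists (Num.max K 0).
  by rewrite le_max lexx orbT.
move=> x t; apply: (le_trans (dual_pointwise x t dT TK)).
by rewrite ler_wpM2r ?hsq_ge0 // le_max lexx.
Qed.

Section Maps.
Hypothesis cX : compact [set: X].

Lemma hip_opnle x (c : R) : nle x c -> opnle (hip x) c.
Proof.
move=> xc y d yd t; apply: (le_trans (hip_cauchy_schwarz x y t)).
by apply: ler_pM; rewrite ?hsq_ge0 //; [exact: xc|exact: yd].
Qed.

Lemma in_dual_hip x : in_dual (hip x).
Proof.
split; [exact: hip_cont|by move=> *; exact: hip_addr|by move=> *; exact: hip_actr|].
have [B hB] := rcont_bounded cX (@rcont_hsq x).
by exists B; apply: hip_opnle.
Qed.

Lemma in_dual_add T S : in_dual T -> in_dual S -> in_dual (dual_add T S).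
Proof.
move=> dT dS; have [cT TD Ta _] := dT; have [cS SD Sa _] := dS.
rewrite /dual_add; split.
- by move=> x; exact: ccontD.
- by move=> x y t; rewrite TD SD addrACA.
- by move=> x a t ca; rewrite Ta // Sa // mulrDl.
have [K K0 TK] := in_dual_bound dT; have [L L0 SL] := in_dual_bound dS.
exists (2 * K + 2 * L); apply: opnleI => [|x t]; first by lra.
apply: (le_trans (csqD _ _)); have := TK x t; have := SL x t; lra.
Qed.

Lemma in_dual_act T a : in_dual T -> ccont a -> in_dual (dual_act T a).
Proof.
move=> dT ca; have [cT TD Ta _] := dT; rewrite /dual_act; split.
- by move=> x; apply: ccontM => //; exact: ccontJ.
- by move=> x y t; rewrite TD mulrDr.
- by move=> x b t cb; rewrite Ta // mulrA.
have [K K0 TK] := in_dual_bound dT; have [B B0 aB] := csq_bounded cX ca.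
exists (B * K); apply: opnleI => [|x t]; first exact: mulr_ge0.
by rewrite csqM csqJ -mulrA; apply: ler_pM; rewrite ?csq_ge0.
Qed.

Lemma dual_act_hip x a : ccont a -> dual_act (hip x) a = hip (hact x a).
Proof. by move=> ca; apply/funext => y; apply/funext => t; rewrite hip_actl. Qed.
Lemma dual_add_hip x y : dual_add (hip x) (hip y) = hip (x + y).
Proof. by apply/funext => z; apply/funext => t; rewrite hip_addl. Qed.

(* Maximise [2 Re T(x) - <x,x>], whose pointwise supremum over [x] is the squared
   norm of [T] at a point, over [x] and over the points of [W]. *)
Lemma dual_local_approx T (W : set X) t0 (eta : R) :
  in_dual T -> open W -> W t0 -> 0 < eta ->
  exists (x : M) (V : set X) (t : X), [/\ open V, V t, V `<=` W &
    forall s y, V s -> csq (T y s - hip x y s) <= eta * hsq y s].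
Proof.
move=> dT oW W0 eta0; have [cT TD Ta _] := dT.
have [K K0 TK] := in_dual_bound dT.
pose e x t := 2 * Re (T x t) - hsq x t.
pose E : set R := [set r | exists x t, W t /\ r = e x t].
have eK x t : e x t <= K.
  by rewrite lerBlDr; apply: Re_le_mean => //; exact: hsq_ge0.
have hE : has_sup E.
  split; first by exists (e 0 t0), 0, t0.
  by exists K => r [x [t [_ ->]]].
have [r [x [t [Wt ->]]] ht] := sup_adherent eta0 hE.
have ce : rcont (e x).
  apply: rcontB; last exact: rcont_hsq.
  by apply: rcontM; [exact: rcontC|have [] := cT x].
exists x, (W `&` [set s | sup E - eta < e x s]), t; split => //.
- by apply: openI => //; exact: rcont_open_gt.
move=> s y [Ws /= hs]; apply: csq_le_variation; first exact: hsq_ge0.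
(* Passing from [x] to [x + y l] changes [e] at [s] by [2 Re (l (T y - <x,y>)) - |l|^2 |y|^2]. As
   [e x s] is within [eta] of the supremum, this gain is at most [eta]. *)
move=> l; have : e (x + hact y (fun _ => l)) s <= sup E.
  by apply: ub_le_sup; [case: hE|exists (x + hact y (fun _ => l)), s].
have cl := @ccont_cst R X l.
rewrite /e in hs *; rewrite TD Ta // hsqD hsq_act // hip_actr // !ReImE; lra.
Qed.

End Maps.
End HilbertModule.

(** * Elements of the bidual *)

Section Bidual.
Variables (R : realType) (X : topologicalType) (M : hmod R X).
Hypotheses (hX : hausdorff_space X) (cX : compact [set: X]).
Local Notation C := (complex R).
Implicit Types (x y z : M) (t s : X) (a : X -> C) (T S : M -> X -> C).
Variable phi : (M -> X -> C) -> X -> C.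
Hypothesis phiP : in_bidual phi.

Lemma bidual_bound : exists2 K : R, 0 <= K &
  forall T c t, in_dual T -> opnle T c -> csq (phi T t) <= K * c.
Proof.
have [_ _ _ [K hK]] := phiP; exists (Num.max K 0).
  by rewrite le_max lexx orbT.
move=> T c t dT Tc; apply: (le_trans (hK T c dT Tc t)).
by rewrite ler_wpM2r ?(opnle_ge0 t dT Tc) // le_max lexx.
Qed.

(** Multiplying [S] by a bump that is 1 at [t] and 0 off [V] keeps [phi S] at [t] and makes the
    bound on [S] global. *)
Lemma bidual_local_bound (K c : R) S (V : set X) t :
  (forall T c t, in_dual T -> opnle T c -> csq (phi T t) <= K * c) ->
  in_dual S -> open V -> V t -> 0 <= c ->
  (forall s y, V s -> csq (S y s) <= c * hsq y s) -> csq (phi S t) <= K * c.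
Proof.
move=> phiK dS oV Vt c0 SV; have [b [cb b01 bt b0]] := urysohn_bump R hX cX oV Vt.
have [_ _ phia _] := phiP.
have ca : ccont (fun s => ((b s)%:C)%C) := ccontC cb.
have dSa := in_dual_act cX dS ca.
have -> : phi S t = phi (dual_act S (fun s => ((b s)%:C)%C)) t.
  by rewrite phia // bt mulr1.
apply: phiK => //; apply: opnleI => // y s; rewrite csqM csqJ csqC.
have [Vs|/b0 ->] := pselect (V s); last by rewrite expr0n mul0r mulr_ge0 ?hsq_ge0.
have /andP[bs0 bs1] := b01 s.
apply: le_trans (SV s y Vs); rewrite ler_piMl ?csq_ge0 //.
by rewrite expr_le1.
Qed.

(** After multiplication by a bump at [t] the two functionals coincide: [phi T] at [t] depends only
    on the germ of [T] at [t]. *)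
Lemma bidual_local_eq T S (V : set X) t : in_dual T -> in_dual S ->
  open V -> V t -> (forall s y, V s -> T y s = S y s) -> phi T t = phi S t.
Proof.
move=> dT dS oV Vt TS; have [b [cb _ bt b0]] := urysohn_bump R hX cX oV Vt.
have [_ _ phia _] := phiP.
have ca : ccont (fun s => ((b s)%:C)%C) := ccontC cb.
suff : phi (dual_act T (fun s => ((b s)%:C)%C)) t =
       phi (dual_act S (fun s => ((b s)%:C)%C)) t.
  by rewrite !phia // bt !mulr1.
congr (phi _ t); apply/funext => y; apply/funext => s; rewrite /dual_act.
have [/TS -> //|/b0 ->] := pselect (V s).
by rewrite conjc0 !mul0r.
Qed.

Definition bidual_restr y : X -> C := phi (hip y).
Local Notation F := bidual_restr.

Lemma in_dual_bidual_restr : in_dual F.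
Proof.
have [phic phiD phia _] := phiP; have [K K0 hK] := bidual_bound.
have dh := in_dual_hip cX; rewrite /F; split.
- by move=> x; exact: phic.
- by move=> x y t; rewrite -dual_add_hip phiD.
- by move=> x a t ca; rewrite -dual_act_hip // phia.
by exists K => x c xc t; apply: hK => //; exact: hip_opnle.
Qed.

(** The local bound for [T - <x,.>], which [phi] sends to [phi T - F x]. *)
Lemma bidual_near (K eta : R) T x (V : set X) t :
  (forall T c t, in_dual T -> opnle T c -> csq (phi T t) <= K * c) ->
  in_dual T -> open V -> V t -> 0 <= eta ->
  (forall s y, V s -> csq (T y s - hip x y s) <= eta * hsq y s) ->
  csq (phi T t - F x t) <= K * eta.
Proof.
move=> phiK dT oV Vt eta0 TV; have [_ phiD _ _] := phiP.
rewrite -(dualN x t in_dual_bidual_restr) -phiD //; last exact: in_dual_hip.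
apply: (bidual_local_bound (V := V)) => //.
  by apply: in_dual_add => //; exact: in_dual_hip.
by move=> s y Vs; rewrite /dual_add hipNl; exact: TV.
Qed.

(* [bidual_norm] is <phi,phi> and [bidual_dist x] is <phi - x, phi - x> for
   Paschke's inner product on M''. *)
Definition bidual_norm t : R := Re (phi F t).
Definition bidual_dist x t : R := bidual_norm t - 2 * Re (F x t) + hsq x t.
Local Notation n := bidual_norm.
Local Notation d := bidual_dist.

Lemma rcont_bidual_norm : rcont n.
Proof. by have [phic _ _ _] := phiP; have [] := phic _ in_dual_bidual_restr. Qed.

Lemma rcont_bidual_dist x : rcont (d x).
Proof.
apply: rcontD; last exact: rcont_hsq.
apply: rcontB; first exact: rcont_bidual_norm.
have [cF _ _ _] := in_dual_bidual_restr.
by apply: rcontM; [exact: rcontC|have [] := cF x].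
Qed.

(** Approximate the functional [F] itself by some [<x,.>] near a point of [W]. Then [phi F] is close
    to [F x], and testing against [x] shows [F x] close to [<x,x>]. *)
Lemma bidual_dense_approx (W : set X) t0 (eta : R) : open W -> W t0 -> 0 < eta ->
  exists x t, [/\ W t, (n t - hsq x t) ^+ 2 <= eta, d x t ^+ 2 <= eta &
    forall y, csq (F y t - hip x y t) <= eta * hsq y t].
Proof.
move=> oW W0 eta0; have [K K0 phiK] := bidual_bound.
have dF := in_dual_bidual_restr.
have K4 : 0 < 6 * K + 4 by lra.
(* The two errors have squares at most [K e] and [2 (K + 1) e]; twice their sum is [(6 K + 4) e]. *)
pose e := Num.min 1 (eta / (6 * K + 4)).
have e0 : 0 < e by rewrite lt_min ltr01 divr_gt0.
have e1 : e <= 1 by rewrite ge_min lexx.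
have eeta : e * (6 * K + 4) <= eta by rewrite -ler_pdivlMr // ge_min lexx orbT.
have [x [V [t [oV Vt VW hV]]]] := dual_local_approx dF oW W0 e0.
have near_phi := bidual_near phiK dF oV Vt (ltW e0) hV.
have FK : csq (F x t) <= K * hsq x t.
  apply: dual_pointwise => // z c zc s; apply: phiK; last exact: hip_opnle.
  exact: in_dual_hip.
have q0 := hsq_ge0 x t; have hx := hV t x Vt.
(* With [q = hsq x t], [q^2 <= 2 |F x|^2 + 2 |F x - <x,x>|^2 <= 2 (K + e) q]. *)
have q2 : hsq x t <= 2 * (K + 1).
  rewrite leNgt; apply/negP => qK.
  have := csqB (F x t) (F x t - hip x x t).
  rewrite opprB addrC subrK hip_xx csqC => h.
  have : 0 < hsq x t * (hsq x t - 2 * (K + 1)) by apply: mulr_gt0; lra.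
  have : 0 <= hsq x t * (1 - e) by apply: mulr_ge0; lra.
  rewrite hip_xx in hx; nra.
have eq : e * hsq x t <= e * (2 * (K + 1)) by rewrite ler_wpM2l // ltW.
have eK : e * K * 6 + e * 4 <= eta by lra.
have eK0 : 0 <= e * K by rewrite mulr_ge0 // ltW.
have h1 := le_trans (Re_sq_le _) near_phi.
have h2 := le_trans (Re_sq_le _) hx.
rewrite !cReB -/(n t) -/(hsq x t) in h1 h2.
exists x, t; split; first exact: VW.
- have := sqr_ge0 (n t - 2 * Re (F x t) + hsq x t); nra.
- have := sqr_ge0 (n t - hsq x t); rewrite /d; nra.
move=> y; apply: le_trans (hV t y Vt) _; apply: ler_wpM2r; first exact: hsq_ge0.
by nra.
Qed.

(** If [d x] were negative at [t], it would be so on a neighbourhood, where some [z] is almost [phi]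
    at a point; there [|z - x|^2] is almost [d x], hence negative. *)
Lemma bidual_dist_ge0 x t : 0 <= d x t.
Proof.
rewrite leNgt; apply/negP => dx; pose B := hsq x t + 1.
have B1 : 1 <= B by rewrite /B lerDr hsq_ge0.
have B0 : 0 < B by lra.
pose del := - d x t / 2; have del0 : 0 < del by rewrite /del; lra.
pose eta := (del / 8) ^+ 2 / B.
have eta0 : 0 < eta by rewrite divr_gt0 ?exprn_gt0 //; lra.
pose W := [set s | d x s < - del] `&` [set s | hsq x s < B].
have oW : open W.
  by apply: openI; apply: rcont_open_lt; [exact: rcont_bidual_dist|exact: rcont_hsq].
have Wt : W t by split; rewrite /= /del /B; lra.
have [z [s [[/= W1 W2] h1 _ h2]]] := bidual_dense_approx oW Wt eta0.
have {}h2 := le_trans (Re_sq_le _) (h2 x).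
have etaB : eta * B = (del / 8) ^+ 2 by rewrite /eta divfK ?gt_eqF.
have h3 : eta * hsq x s <= (del / 8) ^+ 2.
  by rewrite -etaB; apply: ler_wpM2l; exact: ltW.
have h4 : eta <= (del / 8) ^+ 2 by rewrite -etaB ler_peMr // ltW.
have del8 : 0 <= del / 8 by lra.
have /andP[] := sq_le_bound del8 (le_trans h2 h3).
have /andP[] := sq_le_bound del8 (le_trans h1 h4).
have := hsq_ge0 (z - x) s; rewrite hsqB !cReB; move: W1; rewrite /d; lra.
Qed.

Lemma bidual_distD x y t :
  d (x + y) t = d x t - 2 * Re (F y t - hip x y t) + hsq y t.
Proof.
have [_ FD _ _] := in_dual_bidual_restr.
by rewrite /d FD hsqD !ReImE; ring.
Qed.

(** Cauchy-Schwarz for [<phi - x, y>], from nonnegativity of [d (x + y l)] for all constants [l]. *)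
Lemma bidual_cauchy_schwarz x y t :
  csq (F y t - hip x y t) <= d x t * hsq y t.
Proof.
apply: csq_le_variation; first exact: hsq_ge0.
move=> l; have cl := @ccont_cst R X l.
have := bidual_dist_ge0 (x + hact y (fun _ => l)) t.
have [_ _ Fa _] := in_dual_bidual_restr.
by rewrite bidual_distD hsq_act // Fa // hip_actr // -mulrBl (mulrC _ l); lra.
Qed.

(** Triangle inequality through [phi]: expand [d z] around [x] and absorb the cross term by
    Cauchy-Schwarz. *)
Lemma bidual_dist_hsq x z t : hsq (z - x) t <= 2 * d z t + 2 * d x t.
Proof.
have h := bidual_cauchy_schwarz x (z - x) t.
have q0 := hsq_ge0 (z - x) t; have d0 := bidual_dist_ge0 x t.
have : 2 * Re (F (z - x) t - hip x (z - x) t) <= 2 * d x t + hsq (z - x) t / 2.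
  by apply: Re_le_mean; first lra; first lra; apply: (le_trans h); lra.
have := bidual_distD x (z - x) t; rewrite (addrC x) subrK; lra.
Qed.

Lemma bidual_dist0 t : d 0 t = n t.
Proof. by rewrite /d (dual0 t in_dual_bidual_restr) hsq0 /=; ring. Qed.

Lemma hsq_le_bidual_dist x t : hsq x t <= 2 * d x t + 2 * n t.
Proof. by have := bidual_dist_hsq 0 x t; rewrite subr0 bidual_dist0. Qed.

(** As [d] is convex in [x], a pointwise convex combination of approximants with continuous weights,
    each supported where its approximant is good, keeps the bound [eps]. *)
Lemma bidual_glue (eps : R) : 0 < eps -> (forall t, exists x, d x t < eps) ->
  exists x, forall t, d x t <= eps.
Proof.
move=> eps0 /choice[x_ hx]; have [_ FD Fa _] := in_dual_bidual_restr.
have [l hl] : exists l : seq X, forall s, exists2 t, t \in l & d (x_ t) s < eps.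
  apply: (finite_subcover cX (U := fun t => [set s | d (x_ t) s < eps])) => // t.
  by apply: rcont_open_lt; exact: rcont_bidual_dist.
(* [z] is a combination of the local approximants with continuous weights of sum
   [w], and [Q] is the same combination of their squared norms. *)
suff [w [z [Q [cw w0 wl Q0 [hzQ hw]]]]] : exists (w : X -> R) (z : M) (Q : X -> R),
    [/\ rcont w, forall s, 0 <= w s,
        forall t s, t \in l -> d (x_ t) s < eps -> 0 < w s,
        forall s, 0 <= Q s &
        (forall s, hsq z s <= w s * Q s) /\
        (forall s, w s * n s - 2 * Re (F z s) + Q s <= eps * w s)].
  have {}wl s : 0 < w s by have [t tl ht] := hl s; exact: (wl t).
  have ca : ccont (fun s => (((w s)^-1)%:C)%C).
    by apply: ccontC; apply: rcontV => // s; rewrite gt_eqF.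
  exists (hact z (fun s => (((w s)^-1)%:C)%C)) => s.
  rewrite /d Fa // hsq_act // csqC !ReImE mulr0 subr0.
  have ws := wl s; have wi : 0 < (w s)^-1 by rewrite invr_gt0.
  have h1 : (w s)^-1 ^+ 2 * hsq z s <= (w s)^-1 * Q s.
    rewrite expr2 -mulrA; apply: ler_wpM2l; first exact: ltW.
    by rewrite mulrC ler_pdivrMr // mulrC.
  have : (w s)^-1 * (w s * n s - 2 * Re (F z s) + Q s) <= (w s)^-1 * (eps * w s).
    by apply: ler_wpM2l => //; exact: ltW.
  have -> : (w s)^-1 * (eps * w s) = eps by field; rewrite gt_eqF.
  have -> : (w s)^-1 * (w s * n s - 2 * Re (F z s) + Q s) =
    n s - 2 * (Re (F z s) * (w s)^-1) + (w s)^-1 * Q s by field; rewrite gt_eqF.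
  lra.
elim: l {hl} => [|t l [w [z [Q [cw w0 wl Q0 [hzQ hw]]]]]].
  exists (fun _ => 0), 0, (fun _ => 0); split => //; first exact: rcontC.
  split=> s; first by rewrite hsq0 mulr0.
  by rewrite (dual0 s in_dual_bidual_restr) /=; lra.
(* This weight is positive exactly where [x_ t] is good, so it serves as the unnormalised partition
   function. *)
pose b s := Num.max 0 (eps - d (x_ t) s).
have b0 s : 0 <= b s by rewrite le_max lexx.
have cb : rcont b.
  apply: rcont_max; first exact: rcontC.
  by apply: rcontB; [exact: rcontC|exact: rcont_bidual_dist].
have ca : ccont (fun s => ((b s)%:C)%C) := ccontC cb.
exists (fun s => w s + b s), (z + hact (x_ t) (fun s => ((b s)%:C)%C)),
  (fun s => Q s + b s * hsq (x_ t) s); split.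
- exact: rcontD.
- by move=> s; rewrite addr_ge0.
- move=> t' s; rewrite inE => /orP[/eqP ->|t'l] hd.
    by rewrite ltr_wpDl // lt_max subr_gt0 hd orbT.
  by rewrite ltr_wpDr // (wl t').
- by move=> s; rewrite addr_ge0 // mulr_ge0 // hsq_ge0.
split=> s; have bs := b0 s; have h0 := hsq_ge0 (x_ t) s.
  rewrite hsqD hsq_act // csqC hip_actr // cReM cImC mulr0 subr0 cReC.
  have : 2 * Re (hip z (x_ t) s) <= w s * hsq (x_ t) s + Q s.
    apply: Re_le_mean => //; first by rewrite mulr_ge0.
    apply: (le_trans (hip_cauchy_schwarz _ _ _)).
    by rewrite mulrAC ler_wpM2r.
  move=> /(ler_wpM2l bs); have := hzQ s; nra.
have : b s * d (x_ t) s <= b s * eps.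
  rewrite /b; have [h|h] := lerP (eps - d (x_ t) s) 0; last first.
    by apply: ler_wpM2l; [exact: ltW|lra].
  by rewrite !mul0r.
have := hw s; rewrite FD Fa // !ReImE mulr0 subr0 /d; lra.
Qed.

(** Uniform approximants form a Cauchy sequence, whose limit [x] represents [F]. A general [T] is
    close to some [<z,.>] at points of every nonempty open set, so continuity gives equality
    everywhere. *)
Lemma bidual_canonical : (forall t (eps : R), 0 < eps -> exists x, d x t < eps) ->
  exists x, forall T, in_dual T -> forall t, phi T t = canon_bidual x T t.
Proof.
move=> hd; have inv0 (k : nat) : 0 < k.+1%:R^-1 :> R by rewrite invr_gt0 ltr0n.
have /choice[x_ hx] (k : nat) : exists x, forall t, d x t <= k.+1%:R^-1.
  by apply: bidual_glue => // t; exact: hd.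
have small (e : R) : 0 < e -> exists N, forall k, (N <= k)%N -> forall t, d (x_ k) t <= e.
  move=> e0; have [N hN] := inv_succ_le e0.
  by exists N => k Nk t; apply: (le_trans (hx k t)); exact: hN.
have [x xlim] : exists x, forall e : R, 0 < e -> exists N, forall k, (N <= k)%N ->
    forall t, hsq (x_ k - x) t <= e.
  apply: hcomplete => e e0; have e4 : 0 < e / 4 by lra.
  have [N hN] := small _ e4; exists N => i j Ni Nj t.
  have := bidual_dist_hsq (x_ j) (x_ i) t.
  rewrite /hsq; have := hN i Ni t; have := hN j Nj t; lra.
have Fx y t : F y t = hip x y t.
  apply: csq_eq => e e0; have q0 := hsq_ge0 y t.
  have e'0 : 0 < e / (4 * (hsq y t + 1)) by apply: divr_gt0 => //; lra.
  have [N1 h1] := small _ e'0; have [N2 h2] := xlim _ e'0.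
  pose k := maxn N1 N2.
  have {}h1 := h1 k (leq_maxl _ _) t; have {}h2 := h2 k (leq_maxr _ _) t.
  have -> : F y t - hip x y t = (F y t - hip (x_ k) y t) + hip (x_ k - x) y t.
    by rewrite hipBl addrA subrK.
  apply: (le_trans (csqD _ _)).
  have g1 := le_trans (bidual_cauchy_schwarz (x_ k) y t) (ler_wpM2r q0 h1).
  have g2 := le_trans (hip_cauchy_schwarz (x_ k - x) y t) (ler_wpM2r q0 h2).
  have : e / (4 * (hsq y t + 1)) * hsq y t <= e / 4.
    rewrite -mulrA; apply: ler_wpM2l; first exact: ltW.
    rewrite invfM -mulrA ler_piMr ?invr_ge0 // mulrC ler_pdivrMr; lra.
  lra.
exists x => T dT t; have [K K0 phiK] := bidual_bound.
have [phic _ _ _] := phiP; have [cT _ _ _] := dT.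
apply/eqP; rewrite -subr_eq0; apply/eqP/csq_le0; rewrite leNgt; apply/negP => h0.
pose D s := csq (phi T s - canon_bidual x T s).
have cD : rcont D.
  by apply/rcont_csq/ccontB; [exact: phic|apply: ccontJ; exact: cT].
pose B := hsq x t + 1; have q0 := hsq_ge0 x t.
pose W := [set s | D t / 2 < D s] `&` [set s | hsq x s < B].
have oW : open W.
  by apply: openI; [exact: rcont_open_gt|apply: rcont_open_lt; exact: rcont_hsq].
have Wt : W t by split; rewrite /= /B; move: h0; rewrite -/(D t); lra.
(* Makes the error bound [2 (K + B) eta] equal to [D t / 2], which [D] exceeds on [W]. *)
pose eta := D t / 2 / (2 * (K + B)).
have KB : 0 < 2 * (K + B) by rewrite /B; lra.
have eta0 : 0 < eta by apply: divr_gt0 => //; move: h0; rewrite -/(D t); lra.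
have [z [V [s [oV Vs VW hV]]]] := dual_local_approx dT oW Wt eta0.
have [/= W1 W2] := VW s Vs.
have g1 := bidual_near phiK dT oV Vs (ltW eta0) hV.
have g2 := hV s x Vs.
have : D s <= 2 * (K * eta) + 2 * (eta * hsq x s).
  rewrite /D /canon_bidual.
  have -> : phi T s - (T x s)^*%C =
      (phi T s - F z s) - (T x s - hip z x s)^*%C.
    rewrite Fx (hip_conj z x); apply: eq_complexP; rewrite !ReImE; ring.
  apply: (le_trans (csqB _ _)); rewrite csqJ; lra.
have : eta * hsq x s <= eta * B by apply: ler_wpM2l; exact: ltW.
have : eta * (2 * (K + B)) = D t / 2 by rewrite /eta divfK ?gt_eqF.
lra.
Qed.

End Bidual.

(** * From a non-reflexive module to ideals *)

Section VanishingIdeal.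
Variables (R : realType) (X : topologicalType).
Hypotheses (hX : hausdorff_space X) (cX : compact [set: X]).
Local Notation C := (complex R).

Definition vanishing_ideal (V : set X) : set (X -> C) :=
  [set f | ccont f /\ forall t, ~ V t -> f t = 0].

Lemma vanishing_ideal_closed V : closed_ideal (vanishing_ideal V).
Proof.
split.
- by move=> f [].
- by split => //; exact: ccont_cst.
- move=> f g [cf f0] [cg g0]; split; first exact: ccontD.
  by move=> t Vt; rewrite f0 // g0 // addr0.
- move=> f a [cf f0] ca; split; first exact: ccontM.
  by move=> t Vt; rewrite f0 // mul0r.
move=> u f hu cf uf; split => // t Vt; apply: csq_eq => e /uf[N /(_ N (leqnn _) t)].
by have [_ ->] := hu N; rewrite // sub0r subr0 csqN.
Qed.

Lemma vanishing_ideal_bump V t : open V -> V t ->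
  exists2 f, vanishing_ideal V f & f t <> 0.
Proof.
move=> oV Vt; have [b [cb _ bt b0]] := urysohn_bump R hX cX oV Vt.
exists (fun s => ((b s)%:C)%C); first by split; [exact: ccontC|move=> s /b0 ->].
by rewrite bt => /(congr1 (@complex.Re R)) /= /eqP; rewrite oner_eq0.
Qed.

Lemma vanishing_ideal_support V : open V -> ideal_support (vanishing_ideal V) = V.
Proof.
move=> oV; apply/seteqP; split=> t.
  by move=> [f [[_ f0] ft]]; apply: contrapT => /f0.
by move=> /(vanishing_ideal_bump oV)[f If ft]; exists f.
Qed.

End VanishingIdeal.

(** * Vectors on disjoint open sets, almost orthogonal to the generators *)

Section NonReflexive.
Variables (R : realType) (X : topologicalType) (M : hmod R X).
Hypotheses (hX : hausdorff_space X) (cX : compact [set: X]).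
Local Notation C := (complex R).
Implicit Types (x y z : M) (t s : X) (a : X -> C) (T S : M -> X -> C).
Variable phi : (M -> X -> C) -> X -> C.
Hypothesis phiP : in_bidual phi.
Local Notation F := (bidual_restr phi).
Local Notation n := (bidual_norm phi).
Local Notation d := (bidual_dist phi).
Variables (g : nat -> M) (G : nat -> R).
Hypotheses (G0 : forall i, 0 <= G i) (gG : forall i t, hsq (g i) t <= G i).

Lemma rcont_bidual_defect x y :
  rcont (fun t => csq (F y t - hip x y t)).
Proof.
have [cF _ _ _] := in_dual_bidual_restr cX phiP.
by apply/rcont_csq/ccontB; [exact: cF|exact: hip_cont].
Qed.

Lemma open_forall_le (P : nat -> set X) k : (forall i, open (P i)) ->
  open [set t | forall i, (i <= k)%N -> P i t].
Proof.
move=> oP; elim: k => [|k IH].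
  rewrite (_ : [set t | _] = P 0%N) //; apply/seteqP; split => t /=; first by apply.
  by move=> Pt i; rewrite leqn0 => /eqP ->.
rewrite (_ : [set t | _] = [set t | forall i, (i <= k)%N -> P i t] `&` P k.+1).
  exact: openI.
apply/seteqP; split => t /= h; first by split=> [i ik|]; apply: h => //; exact: leqW.
by move=> i; rewrite leq_eqVlt => /orP[/eqP ->|]; [case: h|rewrite ltnS; apply: h.1].
Qed.

(* At [t0] the functional F stays at distance at least [eps] from M; [y] is almost
   closest to it there, whereas [x] is very close to F on a small open set [V]
   near [t0].  On [V] the vector [x - y] is almost orthogonal to any prescribed
   finite part of M, because F - y is so at [t0]. *)
Lemma bidual_escape t0 (eps N : R) (O : set X) (k : nat) :
  0 < eps -> (forall x, eps <= d x t0) -> 0 <= N -> (forall t, n t <= N) ->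
  open O -> O t0 ->
  exists z (V O' : set X), [/\ open V, V !=set0, V `<=` O, open O' & O' t0] /\
    [/\ O' `<=` O, forall t, V t -> ~ O' t,
        forall t i, V t -> (i <= k)%N -> csq (hip z (g i) t) <= (G i + 1) / k.+1%:R,
        forall t, V t -> hsq z t <= 2 * N + 6 &
        forall t, V t -> (eps / 4) ^+ 2 <= csq (F z t)].
Proof.
move=> eps0 heps N0 nN oO Ot0; have dF := in_dual_bidual_restr cX phiP; have [_ FD Fa _] := dF.
have N43 : 0 < 4 * N + 3 by lra.
have k0 : 0 < k.+1%:R :> R by rewrite ltr0n.
(* In order, the upper bounds on [eta] serve the norm of [z], its near-orthogonality to the [g i],
   the gap between [d x] and [d y], and the lower bound on [F z]. *)
have [eta [eta0 eta1 etak etae etaN]] : exists eta : R, [/\ 0 < eta, eta <= 1,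
    eta * (4 * k.+1%:R) <= 1, eta <= eps / 16 & eta * (4 * N + 3) <= (eps / 16) ^+ 2].
  exists (Num.min (Num.min 1 (1 / (4 * k.+1%:R)))
                  (Num.min (eps / 16) ((eps / 16) ^+ 2 / (4 * N + 3)))).
  have e16 : 0 < eps / 16 by lra.
  have k40 : 0 < 4 * k.+1%:R :> R by rewrite mulr_gt0.
  split.
  - by rewrite !lt_min ltr01 e16 !divr_gt0 ?exprn_gt0.
  - by rewrite !ge_min lexx.
  - by rewrite -ler_pdivlMr // !ge_min lexx orbT.
  - by rewrite !ge_min lexx !orbT.
  - by rewrite -ler_pdivlMr // !ge_min lexx !orbT.
pose E : set R := [set r | exists x, r = d x t0].
have hE : has_inf E.
  by split; [exists (d 0 t0), 0|exists eps => r [x ->]].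
have dinf x : inf E <= d x t0 by apply: ge_inf; [case: hE|exists x].
have [r [y ->] hy] := inf_adherent eta0 hE.
have yort x : csq (F x t0 - hip y x t0) <= eta * hsq x t0.
  apply: csq_le_variation; first exact: hsq_ge0.
  move=> l; have cl := @ccont_cst R X l.
  have := dinf (y + hact x (fun _ => l)).
  by rewrite bidual_distD // hsq_act // Fa // hip_actr // -mulrBl (mulrC _ l); lra.
have dyN : d y t0 < N + 1.
  by have := dinf 0; rewrite bidual_dist0 //; have := nN t0; lra.
have qy : hsq y t0 <= 4 * N + 2.
  by have := hsq_le_bidual_dist hX cX phiP y t0; have := nN t0; lra.
pose W := O `&` [set t | eps / 2 < d y t] `&` [set t | d y t < N + 2]
  `&` [set t | csq (F y t - hip y y t) < eta * (4 * N + 3)]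
  `&` [set t | forall i, (i <= k)%N -> csq (F (g i) t - hip y (g i) t) < eta * (G i + 1)].
have oW : open W.
  have cd := @rcont_bidual_dist _ _ _ cX _ phiP y.
  apply: openI; last first.
    apply: (open_forall_le (P := fun i =>
      [set t | csq (F (g i) t - hip y (g i) t) < eta * (G i + 1)])) => i.
    exact/rcont_open_lt/rcont_bidual_defect.
  apply: openI; last exact/rcont_open_lt/rcont_bidual_defect.
  apply: openI; last exact: rcont_open_lt.
  by apply: openI => //; exact: rcont_open_gt.
have Wt0 : W t0.
  split; last first.
    move=> i _; apply: (le_lt_trans (yort (g i))).
    by rewrite ltr_pM2l //; have := gG i t0; lra.
  split; last first.
    by apply: (le_lt_trans (yort y)); rewrite ltr_pM2l //; lra.
  split; last by rewrite /=; lra.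
  by split => //=; have := heps y; lra.
have [x [t1 [Wt1 _ dx1 _]]] :=
  bidual_dense_approx hX cX phiP oW Wt0 (exprn_gt0 2 (divr_gt0 eta0 (ltr0n R 2))).
have {}dx1 : d x t1 < eta.
  have e2 : 0 <= eta / 2 by lra.
  have /andP[_] := sq_le_bound e2 dx1; lra.
have cdx := @rcont_bidual_dist _ _ _ cX _ phiP x.
(* [V] lies where [x] is close to [phi] and [O'] where it is far, so they are disjoint; [t0] is in
   [O'] because every vector is far from [phi] there. *)
exists (x - y), (W `&` [set t | d x t < eta]), (O `&` [set t | eps / 2 < d x t]).
split; split.
- by apply: openI => //; exact: rcont_open_lt.
- by exists t1.
- by move=> t [[[[[]]]]].
- by apply: openI => //; exact: rcont_open_gt.
- by split => //=; have := heps x; lra.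
- by move=> t [].
- by move=> t [_ /= h1] [_ /= h2]; lra.
- move=> t i [[_ /= hW] /= dxt] ik; have {}hW := hW i ik.
  have -> : hip (x - y) (g i) t =
      (F (g i) t - hip y (g i) t) - (F (g i) t - hip x (g i) t).
    by rewrite hipBl; ring.
  apply: (le_trans (csqB _ _)); rewrite ler_pdivlMr //.
  have h1 := bidual_cauchy_schwarz hX cX phiP x (g i) t.
  have h2 : d x t * hsq (g i) t <= eta * G i.
    by apply: ler_pM; [exact: bidual_dist_ge0|exact: hsq_ge0|exact: ltW|exact: gG].
  have h3 : eta * (4 * k.+1%:R) * (G i + 1) <= 1 * (G i + 1).
    by apply: ler_wpM2r => //; have := G0 i; lra.
  apply: le_trans (_ : (4 * (eta * (G i + 1))) * k.+1%:R <= _).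
    by apply: ler_wpM2r; [exact: ltW|lra].
  lra.
- move=> t [[[[_ /= dy2] _] _] /= dxt].
  have := bidual_dist_hsq hX cX phiP y x t; lra.
move=> t [[[[[_ /= dy1] _] /= Fy] _] /= dxt].
have e16 : 0 <= eps / 16 by lra.
have dx0 := bidual_dist_ge0 hX cX phiP x t.
have h1 := bidual_cauchy_schwarz hX cX phiP x x t.
have qx : hsq x t <= 4 * N + 3.
  by have := hsq_le_bidual_dist hX cX phiP x t; have := nN t; lra.
have {}h1 : csq (F x t - hip x x t) <= (eps / 16) ^+ 2.
  apply: (le_trans h1); apply: le_trans etaN.
  by apply: ler_pM => //; [exact: hsq_ge0|exact: ltW].
have h2 := le_trans (ltW Fy) etaN.
have /andP[a1 b1] := sq_le_bound e16 (le_trans (Re_sq_le _) h1).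
have /andP[a2 b2] := sq_le_bound e16 (le_trans (Re_sq_le _) h2).
(* Up to [eps / 16] each, [|x|^2] is [Re F x] and [|y|^2] is [Re F y], so [d y - d x] is
   [Re F (x - y)] up to [eps / 8]. *)
have h : eps / 4 <= Re (F (x - y) t).
  rewrite (dualB _ _ _ dF) cReB; move: a1 b1 a2 b2 dy1 dxt.
  rewrite !cReB /bidual_dist -!/(hsq _ t); lra.
apply: le_trans (Re_sq_le _); nra.
Qed.

(** Iterate inside shrinking neighbourhoods [O k] of [t0]: [V k] lies in [O k] and misses [O k.+1],
    which contains all later [V l]. *)
Lemma bidual_escape_seq t0 (eps N : R) :
  0 < eps -> (forall x, eps <= d x t0) -> 0 <= N -> (forall t, n t <= N) ->
  exists (z : nat -> M) (V : nat -> set X),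
  [/\ forall k, open (V k) /\ V k !=set0,
      forall k l t, V k t -> V l t -> k = l,
      forall k t i, V k t -> (i <= k)%N ->
        csq (hip (z k) (g i) t) <= (G i + 1) / k.+1%:R,
      forall k t, V k t -> hsq (z k) t <= 2 * N + 6 &
      forall k t, V k t -> (eps / 4) ^+ 2 <= csq (F (z k) t)].
Proof.
move=> eps0 heps N0 nN; have /choice[r hr] (p : nat * set X) : exists r : M * set X * set X,
    open p.2 -> p.2 t0 ->
    [/\ open r.1.2, r.1.2 !=set0, r.1.2 `<=` p.2, open r.2 & r.2 t0] /\
    [/\ r.2 `<=` p.2, forall t, r.1.2 t -> ~ r.2 t,
        forall t i, r.1.2 t -> (i <= p.1)%N ->
          csq (hip r.1.1 (g i) t) <= (G i + 1) / p.1.+1%:R,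
        forall t, r.1.2 t -> hsq r.1.1 t <= 2 * N + 6 &
        forall t, r.1.2 t -> (eps / 4) ^+ 2 <= csq (F r.1.1 t)].
  have [[oO Ot0]|h] := pselect (open p.2 /\ p.2 t0); last first.
    (* Default for a set that is not an open neighbourhood of [t0]; the recursion never meets it. *)
    by exists (0, set0, set0) => ? ?; case: h.
  have [z [V [O' h]]] := bidual_escape p.1 eps0 heps N0 nN oO Ot0.
  by exists (z, V, O').
pose O := fix O k := if k is k'.+1 then (r (k', O k')).2 else [set: X].
have hO k : open (O k) /\ O k t0.
  elim: k => [|k [oO Ot]]; first by split => //; exact: openT.
  by have [[_ _ _ ? ?] _] := hr (k, O k) oO Ot.
have hk k := hr (k, O k) (hO k).1 (hO k).2.
have Omono k l : (k <= l)%N -> O l `<=` O k.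
  elim: l => [|l IH]; first by rewrite leqn0 => /eqP ->.
  rewrite leq_eqVlt => /orP[/eqP -> //|]; rewrite ltnS => /IH kl.
  by apply: subset_trans kl; have [_ []] := hk l.
have disj k l t : (k < l)%N -> (r (k, O k)).1.2 t -> (r (l, O l)).1.2 t -> False.
  move=> kl kt lt; have [_ [_ /(_ t kt) kO _ _ _]] := hk k; apply: kO.
  by have [[_ _ /(_ t lt) /(Omono _ _ kl) ? _ _] _] := hk l.
exists (fun k => (r (k, O k)).1.1), (fun k => (r (k, O k)).1.2); split.
- by move=> k; have [[? ? _ _ _] _] := hk k.
- move=> k l t kt lt; have [kl|kl|//] := ltngtP k l; exfalso.
    exact: (disj k l t).
  exact: (disj l k t).
- by move=> k; have [_ [_ _ h _ _]] := hk k.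
- by move=> k; have [_ [_ _ _ h _]] := hk k.
- by move=> k; have [_ [_ _ _ _ h]] := hk k.
Qed.

(** * Extending bounded sequences by means of [phi] *)

Section Extension.
Hypothesis gM : forall x (e : R), 0 < e ->
    exists (m : nat) (a : nat -> X -> C), (forall i, ccont (a i)) /\
      nle (x - \sum_(i < m) hact (g i) (a i)) e.
Variables (z : nat -> M) (V : nat -> set X) (B del : R).
Hypotheses (del0 : 0 < del) (oV : forall k, open (V k)).
Hypothesis disjV : forall k l t, V k t -> V l t -> k = l.
Hypothesis zg : forall k t i, V k t -> (i <= k)%N ->
        csq (hip (z k) (g i) t) <= (G i + 1) / k.+1%:R.
Hypothesis zB : forall k t, V k t -> hsq (z k) t <= B.
Hypothesis Fz : forall k t, V k t -> del <= csq (F (z k) t).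

(** Near-orthogonality to the generators passes to their span, and by the uniform bound on [z k]
    over [V k] to its closure. *)
Lemma hip_tail_small y (e : R) : 0 < e ->
  exists m, forall k t, (m <= k)%N -> V k t -> csq (hip (z k) y t) <= e.
Proof.
pose small y := forall e : R, 0 < e ->
  exists m, forall k t, (m <= k)%N -> V k t -> csq (hip (z k) y t) <= e.
have smallD x x' : small x -> small x' -> small (x + x').
  move=> sx sx' r r0; have r4 : 0 < r / 4 by lra.
  have [m hm] := sx _ r4; have [m' hm'] := sx' _ r4.
  exists (maxn m m') => k t; rewrite geq_max => /andP[mk m'k] Vt.
  rewrite hip_addr; apply: (le_trans (csqD _ _)).
  by have := hm k t mk Vt; have := hm' k t m'k Vt; lra.
have small_act i a : ccont a -> small (hact (g i) a).
  move=> ca r r0; have [A A0 aA] := csq_bounded cX ca.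
  have G1 : 0 < G i + 1 by have := G0 i; lra.
  have A1 : 0 < A + 1 by lra.
  have GA : 0 < (G i + 1) * (A + 1) by exact: mulr_gt0.
  have [m hm] := inv_succ_le (divr_gt0 r0 GA).
  (* [k >= i] makes the estimate for [g i] available, [k >= m] makes it small. *)
  exists (maxn m i) => k t; rewrite geq_max => /andP[mk ik] Vt.
  rewrite hip_actr // csqM; have h1 := zg Vt ik.
  have h2 : (G i + 1) / k.+1%:R <= (G i + 1) * (r / ((G i + 1) * (A + 1))).
    by apply: ler_wpM2l; [exact: ltW|exact: hm].
  have h3 : (G i + 1) * (r / ((G i + 1) * (A + 1))) = r / (A + 1).
    by field; rewrite !gt_eqF.
  apply: le_trans (_ : r / (A + 1) * (A + 1) <= _); last by rewrite divfK ?gt_eqF.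
  apply: ler_pM; rewrite ?csq_ge0 //; first by apply: (le_trans h1); rewrite -h3.
  by have := aA t; lra.
move=> e0.
have B1 : 0 < `|B| + 1 by rewrite ltr_wpDl.
have e'0 : 0 < e / (4 * (`|B| + 1)) by apply: divr_gt0 => //; lra.
have [m [a [ca ya]]] := gM y e'0.
have sS : small (\sum_(i < m) hact (g i) (a i)).
  elim/big_ind: _ => // [r r0|i _]; last exact: small_act.
  by exists 0%N => k t _ _; rewrite hip0r csq0 ltW.
have e4 : 0 < e / 4 by lra.
have [m' hm'] := sS _ e4; exists m' => k t m'k Vt.
rewrite -[y](subrK (\sum_(i < m) hact (g i) (a i))) hip_addr.
apply: (le_trans (csqD _ _)); have h1 := hm' k t m'k Vt.
suff : csq (hip (z k) (y - \sum_(i < m) hact (g i) (a i)) t) <= e / 4 by lra.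
apply: (le_trans (hip_cauchy_schwarz _ _ _)).
apply: le_trans (_ : (`|B| + 1) * (e / (4 * (`|B| + 1))) <= _); last first.
  by rewrite le_eqVlt; apply/orP; left; apply/eqP; field; rewrite gt_eqF.
apply: ler_pM; rewrite ?hsq_ge0 //; last exact: ya.
by apply: (le_trans (zB Vt)); have := ler_norm B; lra.
Qed.

(** On [V k] the functional [T] is [<z k c k, .>] with [c k = lam k / F (z k)], so by locality
    [phi T] is [F (z k) c k = lam k] there. *)
Lemma bidual_extension (lam : nat -> X -> C) (L : R) :
  (forall k, vanishing_ideal (V k) (lam k)) -> (forall k t, csq (lam k t) <= L) ->
  exists f : X -> C, [/\ ccont f, forall k t, V k t -> f t = lam k t &
    forall t, ~ closure (\bigcup_k V k) t -> f t = 0].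
Proof.
move=> lamV lamL; have dF := in_dual_bidual_restr cX phiP; have [cF _ Fa _] := dF.
(* Truncation from below makes the division continuous on all of [X] and changes nothing on
   [V k]. *)
pose m k s := Num.max (csq (F (z k) s)) del.
have m0 k s : 0 < m k s by rewrite lt_max del0 orbT.
pose c k s := lam k s * (F (z k) s)^*%C * (((m k s)^-1)%:C)%C.
have cc k : ccont (c k).
  apply: ccontM; first by apply: ccontM; [have [] := lamV k|apply: ccontJ; exact: cF].
  apply: ccontC; apply: rcontV; first by move=> s; rewrite gt_eqF.
  by apply: rcont_max; [exact: rcont_csq|exact: rcontC].
have c0 k s : ~ V k s -> c k s = 0.
  by move=> Vs; have [_ l0] := lamV k; rewrite /c l0 // !mul0r.
have cF' k s : V k s -> F (z k) s * c k s = lam k s.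
  move=> Vs; have Fd := Fz Vs.
  have ms : m k s = csq (F (z k) s) by rewrite /m max_l.
  have one : F (z k) s * (F (z k) s)^*%C * (((m k s)^-1)%:C)%C = 1.
    rewrite mulrC (mulrC (F _ _)) mulJc -ms; apply: eq_complexP; rewrite !ReImE.
      by rewrite mulr0 subr0 mulVf ?gt_eqF.
    by rewrite mulr0 mul0r addr0.
  rewrite -[RHS]mulr1 -one /c; ring.
have cL k s : csq (c k s) <= `|L| / del.
  rewrite /c !csqM csqJ csqC -mulrA; apply: ler_pM; rewrite ?csq_ge0 //.
  - by rewrite mulr_ge0 ?csq_ge0 ?sqr_ge0.
  - exact: le_trans (lamL k s) (ler_norm L).
  apply: le_trans (_ : m k s * (m k s)^-1 ^+ 2 <= _).
    by apply: ler_wpM2r; rewrite ?sqr_ge0 // le_max lexx.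
  rewrite expr2 mulrA mulfV ?gt_eqF // mul1r lef_pV2 ?posrE //.
  by rewrite le_max lexx orbT.
(* Index of the set containing [s]. Off the union it defaults to 0, where [T] still vanishes because
   [c 0] does. *)
pose kap s := xget 0%N [set k | V k s].
have kapV k s : V k s -> kap s = k.
  by move=> Vs; rewrite /kap; case: xgetP => [j -> /= Vj|/(_ k)]; [exact: disjV Vj Vs|].
pose zc k := hact (z k) (c k).
pose T y s := hip (zc (kap s)) y s.
have hzc0 k y s : ~ V k s -> hip (zc k) y s = 0.
  by move=> Vs; rewrite /zc hip_actl // c0 // conjc0 mul0r.
have TV k y s : V k s -> T y s = hip (zc k) y s by move=> Vs; rewrite /T (kapV k).
have T0 y s : ~ (exists k, V k s) -> T y s = 0.
  by move=> h; apply: hzc0 => Vs; apply: h; exists (kap s).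
have LB0 : 0 <= `|L| / del by rewrite divr_ge0 // ltW.
have dT : in_dual T.
  split.
  (* Partial sums converge uniformly: at each point at most one term is nonzero, and late terms are
     small by [hip_tail_small]. *)
  - move=> y; apply: ccont_uniform_limit => e e0.
    have L1 : 0 < `|L| / del + 1 by lra.
    have [N hN] := hip_tail_small y (divr_gt0 e0 L1).
    exists (hip (\sum_(k < N) zc k) y); first exact: hip_cont.
    move=> s; have hsum : hip (\sum_(k < N) zc k) y s = \sum_(k < N) hip (zc k) y s.
      by apply: (big_morph (fun x => hip x y s)) => [x x'|]; rewrite ?hip_addl ?hip0l.
    have [[k Vk]|h] := pselect (exists k, V k s); last first.
      rewrite T0 // hsum big1 ?subrr ?csq0 ?ltW // => k _; apply: hzc0 => Vk.
      by apply: h; exists k.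
    rewrite (TV k) // hsum; have [kN|Nk] := ltnP k N.
      rewrite (bigD1 (Ordinal kN)) //= big1 ?addr0 ?subrr ?csq0 ?ltW // => j jk.
      apply: hzc0 => Vj; move/eqP: jk; apply; apply: val_inj => /=.
      exact: disjV Vj Vk.
    rewrite big1 ?subr0 => [|j _]; last first.
      apply: hzc0 => Vj; have jk := disjV Vj Vk.
      by have := ltn_ord j; rewrite jk ltnNge Nk.
    rewrite /zc hip_actl // csqM csqJ.
    apply: le_trans (_ : (`|L| / del + 1) * (e / (`|L| / del + 1)) <= _).
      by apply: ler_pM; rewrite ?csq_ge0 //; [have := cL k s; lra|exact: hN].
    by rewrite mulrC divfK ?gt_eqF.
  - by move=> x y s; rewrite /T hip_addr.
  - by move=> x a s ca; rewrite /T hip_actr.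
  exists (`|L| / del * `|B|); apply: opnleI; first by rewrite mulr_ge0.
  move=> y s; have [[k Vk]|h] := pselect (exists k, V k s); last first.
    rewrite T0 // csq0; apply: mulr_ge0; last exact: hsq_ge0.
    exact: mulr_ge0.
  rewrite (TV k) // /zc hip_actl // csqM csqJ -(mulrA (`|L| / del)).
  apply: ler_pM; rewrite ?csq_ge0 //.
  apply: (le_trans (hip_cauchy_schwarz _ _ _)).
  by apply: ler_wpM2r; rewrite ?hsq_ge0 //; exact: le_trans (zB Vk) (ler_norm B).
exists (phi T); have [phic _ _ _] := phiP; split; first exact: phic.
- move=> k t Vt.
  rewrite (bidual_local_eq hX cX phiP dT (in_dual_hip cX (zc k)) (oV k) Vt).
    by rewrite -/(F (zc k) t) Fa // cF'.
  by move=> s y Vs; exact: TV.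
move=> t ht; have oU : open (~` closure (\bigcup_k V k)).
  by apply: closed_openC; exact: closed_closure.
rewrite (bidual_local_eq hX cX phiP dT (in_dual_hip cX 0) oU ht).
  exact: (dual0 t dF).
move=> s y hs; rewrite hip0l T0 // => -[k Vk]; apply: hs.
by apply: subset_closure; exists k.
Qed.

End Extension.
End NonReflexive.

Lemma nonreflexive_ideals (R : realType) (X : topologicalType) (M : hmod R X) :
  hausdorff_space X -> compact [set: X] ->
  countably_generated M -> ~ cstar_reflexive M ->
  exists I : nat -> set (X -> complex R),
    [/\ forall k, closed_ideal (I k), forall k, nonzero_ideal (I k),
        forall k l, k <> l -> orthogonal_ideals (I k) (I l)
      & prod_canon_included I].
Proof.
move=> hX cX [g gM] nrM.
have [phi phiP nphi] : exists2 phi, in_bidual phi &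
    ~ exists x : M, forall T, in_dual T -> forall t, phi T t = canon_bidual x T t.
  by apply: contrapT => h; apply: nrM => phi phiP; apply: contrapT => h'; apply: h; exists phi.
have [t0 [eps eps0 heps]] : exists t0, exists2 eps : R, 0 < eps &
    forall x, eps <= bidual_dist phi x t0.
  apply: contrapT => h; apply: nphi; apply: bidual_canonical => // t eps eps0.
  apply: contrapT => h'; apply: h; exists t, eps => // x.
  by rewrite leNgt; apply/negP => hx; apply: h'; exists x.
have /choice[G hG] (i : nat) : exists r : R, 0 <= r /\ forall t, hsq (g i) t <= r.
  have [r hr] := rcont_bounded cX (@rcont_hsq _ _ _ (g i)); exists (Num.max r 0).
  by split=> [|t]; rewrite le_max ?lexx ?orbT ?hr.
have [N nN] := rcont_bounded cX (rcont_bidual_norm cX phiP).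
have N0 : 0 <= N.
  by apply: le_trans (nN t0); rewrite -bidual_dist0 //; exact: bidual_dist_ge0.
have [z [V [oV disjV zg zB Fz]]] := bidual_escape_seq hX cX phiP
  (fun i => (hG i).1) (fun i => (hG i).2) eps0 heps N0 nN.
exists (fun k => vanishing_ideal (R := R) (V k)); split.
- by move=> k; exact: vanishing_ideal_closed.
- move=> k; have [oVk [t Vt]] := oV k.
  by have [f If ft] := vanishing_ideal_bump R hX cX oVk Vt; exists f; split => //; exists t.
- move=> k l kl f h [_ f0] [_ h0] t; have [Vk|/f0 ->] := pselect (V k t); last by rewrite mul0r.
  by rewrite h0 ?mulr0 // => Vl; apply: kl; exact: disjV Vk Vl.
move=> lam lamI [L lamL].
have e4 : 0 < (eps / 4) ^+ 2 by rewrite exprn_gt0 //; lra.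
have [f [cf fV f0]] := bidual_extension hX cX phiP (fun i => (hG i).1) gM e4
  (fun k => (oV k).1) disjV zg zB Fz lamI lamL.
have sup k := vanishing_ideal_support R hX cX (oV k).1.
exists f; split => //; first by move=> k t; rewrite sup; exact: fV.
by under eq_bigcupr => k _ do rewrite sup.
Qed.

(** * From ideals to a non-reflexive module *)

Section ClosedIdeals.
Variables (R : realType) (X : topologicalType).
Local Notation C := (complex R).

(** The multiples [lam |g|^2 / (|g|^2 + r)] of [g], with [r = 1/(k+1)], converge uniformly to [lam]:
    the squared error is at most [K r]. *)
Lemma closed_ideal_dominated (I : set (X -> C)) g lam (K : R) :
  closed_ideal I -> I g -> ccont lam -> 0 <= K ->
  (forall t, csq (lam t) <= K * csq (g t)) -> I lam.
Proof.
move=> [Icont _ _ Imul Iclosed] Ig cl K0 hl.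
have cg := Icont _ Ig.
have den (k : nat) t : 0 < csq (g t) + k.+1%:R^-1.
  by rewrite ltr_wpDl ?csq_ge0 // invr_gt0 ltr0n.
pose u (k : nat) t := g t * ((g t)^*%C * lam t * (((csq (g t) + k.+1%:R^-1)^-1)%:C)%C).
apply: (Iclosed u) => // [k|e e0].
  apply: Imul => //; apply: ccontM; first by apply: ccontM => //; exact: ccontJ.
  apply: ccontC; apply: rcontV; first by move=> t; rewrite gt_eqF.
  by apply: rcontD; [exact: rcont_csq|exact: rcontC].
have K1 : 0 < K + 1 by lra.
have [N hN] := inv_succ_le (divr_gt0 e0 K1); exists N => k Nk t.
have := den k t; have := hN k Nk; have k0 : 0 < k.+1%:R^-1 :> R by rewrite invr_gt0 ltr0n.
rewrite /u; move: (k.+1%:R^-1) k0 => r r0 re sr.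
have s0 := csq_ge0 (g t); set s := csq (g t) in s0 sr *.
have -> : g t * ((g t)^*%C * lam t * (((s + r)^-1)%:C)%C) - lam t =
    - (lam t * ((r / (s + r))%:C)%C).
  have e1 : g t * (g t)^*%C = (s%:C)%C by rewrite mulrC mulJc.
  transitivity (lam t * (g t * (g t)^*%C * (((s + r)^-1)%:C)%C - 1)); first by ring.
  rewrite e1 -mulrN; congr (_ * _); apply: eq_complexP; rewrite !ReImE /=.
    by field; rewrite gt_eqF.
  by rewrite mulr0 mul0r addr0 subr0 oppr0.
rewrite csqN csqM csqC; apply: le_trans (_ : K * r <= _); last first.
  apply: le_trans (_ : (K + 1) * (e / (K + 1)) <= _).
    by apply: ler_pM => //; [exact: ltW|lra].
  by rewrite mulrC divfK ?gt_eqF.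
apply: le_trans (ler_wpM2r (sqr_ge0 _) (hl t)) _; rewrite -mulrA ler_wpM2l //.
rewrite expr_div_n mulrA ler_pdivrMr ?exprn_gt0 // -/s.
have : 0 <= r * (s ^+ 2 + s * r + r ^+ 2).
  apply: mulr_ge0; first exact: ltW.
  by have := mulr_ge0 s0 (ltW r0); have := sqr_ge0 s; have := sqr_ge0 r; lra.
nra.
Qed.

(** Multiply [f] by the conjugate of [f t0] and divide by [max(|f|^2, |f t0|^2)]. *)
Lemma closed_ideal_peak (I : set (X -> C)) : closed_ideal I -> nonzero_ideal I ->
  exists g, [/\ I g, forall t, csq (g t) <= 1 & exists t0, g t0 = 1].
Proof.
move=> [Icont _ _ Imul _] [f [If [t0 ft0]]]; have cf := Icont _ If.
have m0 := csq_gt0 ft0; set m := csq (f t0) in m0.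
pose p t := Num.max (csq (f t)) m.
have p0 t : 0 < p t by rewrite lt_max m0 orbT.
exists (fun t => f t * ((f t0)^*%C * (((p t)^-1)%:C)%C)); split.
- apply: Imul => //; apply: ccontM; first exact: ccont_cst.
  apply: ccontC; apply: rcontV; first by move=> t; rewrite gt_eqF.
  by apply: rcont_max; [exact: rcont_csq|exact: rcontC].
- move=> t; rewrite !csqM csqJ csqC -/m mulrA exprVn ler_pdivrMr ?exprn_gt0 //.
  rewrite mul1r expr2; apply: ler_pM; rewrite ?csq_ge0 ?(ltW m0) //.
    by rewrite le_max lexx.
  by rewrite le_max lexx orbT.
exists t0; rewrite mulrA (mulrC (f t0)) mulJc -/m /p max_l //.
apply: eq_complexP; rewrite !ReImE; first by rewrite mulr0 subr0 mulfV ?gt_eqF.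
by rewrite mulr0 mul0r addr0.
Qed.

(** [U] together with the exterior of its closure is dense. This yields uniqueness of the extensions
    in [prod_canon_included]. *)
Lemma dense_le (h : X -> R) (U : set X) (c : R) : rcont h ->
  (forall t, U t -> h t <= c) -> (forall t, ~ closure U t -> h t <= c) ->
  forall t, h t <= c.
Proof.
move=> ch hU hnU t; have [/= clU|] := pselect (closure U t); last exact: hnU.
rewrite leNgt; apply/negP => ct.
have [s [Us /= cs]] := clU _ (rcont_near_gt ch ct).
by have := hU s Us; rewrite leNgt cs.
Qed.

Lemma dense_eq (f g : X -> C) (U : set X) : ccont f -> ccont g ->
  (forall t, U t -> f t = g t) -> (forall t, ~ closure U t -> f t = g t) ->
  forall t, f t = g t.
Proof.
move=> cf cg hU hnU t; apply/eqP; rewrite -subr_eq0; apply/eqP/csq_le0.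
apply: (dense_le (h := fun t => csq (f t - g t)) (U := U)).
- by apply/rcont_csq/ccontB.
- by move=> s /hU ->; rewrite subrr csq0.
by move=> s /hnU ->; rewrite subrr csq0.
Qed.

End ClosedIdeals.

(** The limit is the supremum of the eventual lower bounds. One [l] serves all pairs [e], [N], so a
    rate uniform over a family of sequences is inherited by their limits. *)
Lemma real_cauchy_limit (R : realType) (r : nat -> R) :
  (forall e, 0 < e -> exists N, forall i j, (N <= i)%N -> (N <= j)%N ->
    r i - r j <= e) ->
  exists l, forall e N, (forall i j, (N <= i)%N -> (N <= j)%N -> r i - r j <= e) ->
    forall i, (N <= i)%N -> - e <= r i - l <= e.
Proof.
move=> cr; pose E : set R := [set s | exists N, forall i, (N <= i)%N -> s <= r i].
have El e N (h : forall i j, (N <= i)%N -> (N <= j)%N -> r i - r j <= e) i :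
    (N <= i)%N -> E (r i - e).
  by move=> Ni; exists N => j Nj; have := h i j Ni Nj; lra.
have Eu e N (h : forall i j, (N <= i)%N -> (N <= j)%N -> r i - r j <= e) i :
    (N <= i)%N -> ubound E (r i + e).
  move=> Ni s [m hm]; have := hm _ (leq_maxl m N).
  by have := h _ _ (leq_maxr m N) Ni; lra.
have [N0 hN0] := cr 1 ltr01.
have hE : has_sup E.
  by split; [exists (r N0 - 1); exact: El hN0 _ _|exists (r N0 + 1); exact: Eu hN0 _ _].
exists (sup E) => e N h i Ni; apply/andP; split.
  by have := ge_sup hE.1 (Eu e N h i Ni); lra.
by have := ub_le_sup hE.2 (El e N h i Ni); lra.
Qed.

Lemma complex_cauchy_limit (R : realType) (u : nat -> complex R) :
  (forall e : R, 0 < e -> exists N, forall i j, (N <= i)%N -> (N <= j)%N ->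
    csq (u i - u j) <= e) ->
  exists l, forall (e : R) N, 0 < e ->
    (forall i j, (N <= i)%N -> (N <= j)%N -> csq (u i - u j) <= e ^+ 2) ->
    forall i, (N <= i)%N -> csq (u i - l) <= 2 * e ^+ 2.
Proof.
move=> cu.
have hRe (e : R) i j : 0 < e -> csq (u i - u j) <= e ^+ 2 ->
    Re (u i) - Re (u j) <= e.
  move=> e0 h; have := le_trans (Re_sq_le _) h.
  by move=> /(sq_le_bound (ltW e0))/andP[_]; rewrite cReB.
have hIm (e : R) i j : 0 < e -> csq (u i - u j) <= e ^+ 2 ->
    Im (u i) - Im (u j) <= e.
  move=> e0 h; have := le_trans (Im_sq_le _) h.
  by move=> /(sq_le_bound (ltW e0))/andP[_]; rewrite cImB.
have [a ha] : exists l, forall e N,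
    (forall i j, (N <= i)%N -> (N <= j)%N -> Re (u i) - Re (u j) <= e) ->
    forall i, (N <= i)%N -> - e <= Re (u i) - l <= e.
  apply: real_cauchy_limit => e e0; have [N hN] := cu _ (exprn_gt0 2 e0).
  by exists N => i j Ni Nj; apply: hRe => //; exact: hN.
have [b hb] : exists l, forall e N,
    (forall i j, (N <= i)%N -> (N <= j)%N -> Im (u i) - Im (u j) <= e) ->
    forall i, (N <= i)%N -> - e <= Im (u i) - l <= e.
  apply: real_cauchy_limit => e e0; have [N hN] := cu _ (exprn_gt0 2 e0).
  by exists N => i j Ni Nj; apply: hIm => //; exact: hN.
exists (complex.Complex a b) => e N e0 hN i Ni.
have /andP[? ?] := ha e N (fun i j Ni Nj => hRe e i j e0 (hN i j Ni Nj)) i Ni.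
have /andP[? ?] := hb e N (fun i j Ni Nj => hIm e i j e0 (hN i j Ni Nj)) i Ni.
rewrite /csq cReB cImB /=.
have h1 : (Re (u i) - a) ^+ 2 <= e ^+ 2 by nra.
have h2 : (Im (u i) - b) ^+ 2 <= e ^+ 2 by nra.
lra.
Qed.

(** * The Hilbert module [C_0(U)] *)

Section VanishingModule.
Variables (R : realType) (X : topologicalType) (U : set X).
Local Notation C := (complex R).

(** A boolean predicate, so that [C_0(U)] inherits its group structure as a subtype. *)
Definition vanishing_pred : {pred X -> C} :=
  [pred f | `[< vanishing_ideal U f >]].

Lemma vanishing_pred_zmod : zmod_closed vanishing_pred.
Proof.
split=> [|f g /asboolP[cf f0] /asboolP[cg g0]]; apply/asboolP; split => //.
- exact: ccont_cst.
- exact: ccontB.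
by move=> t Ut; rewrite !fctE f0 // g0 // subrr.
Qed.

HB.instance Definition _ :=
  GRing.isZmodClosed.Build (X -> C) vanishing_pred vanishing_pred_zmod.

Record vanishing := Vanishing {
  vanishing_val : X -> C; _ : vanishing_val \in vanishing_pred }.

HB.instance Definition _ := [isSub for vanishing_val].
HB.instance Definition _ := [Choice of vanishing by <:].
HB.instance Definition _ := [SubChoice_isSubZmodule of vanishing by <:].

Local Notation v := vanishing_val.

Lemma vanishingP (x : vanishing) : vanishing_ideal U (v x).
Proof. by case: x => f /= /asboolP. Qed.

(** The action is total in [a]; if the product is not in [C_0(U)], which takes a discontinuous [a],
    it returns [x]. *)
Definition vanishing_act (x : vanishing) (a : X -> C) : vanishing :=
  insubd x (fun t => v x t * a t).

Lemma vanishing_actE x a t : ccont a -> v (vanishing_act x a) t = v x t * a t.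
Proof.
move=> ca; rewrite /vanishing_act /insubd insubT //=.
apply/asboolP; have [cx x0] := vanishingP x; split; first exact: ccontM.
by move=> s Us; rewrite x0 // mul0r.
Qed.

Lemma vanishing_eqP (x y : vanishing) : (forall t, v x t = v y t) -> x = y.
Proof. by move=> xy; apply/val_inj/funext. Qed.

Lemma vanishingD (x y : vanishing) t : v (x + y) t = v x t + v y t.
Proof. by have -> : v (x + y) = v x + v y by []. Qed.
Lemma vanishingB (x y : vanishing) t : v (x - y) t = v x t - v y t.
Proof. by have -> : v (x - y) = v x - v y by []. Qed.

Definition vanishing_ip (x y : vanishing) t : C := (v x t)^*%C * v y t.

Lemma vanishing_ipE x t : vanishing_ip x x t = ((csq (v x t))%:C)%C.
Proof. exact: mulJc. Qed.

Lemma vanishing_complete (u : nat -> vanishing) :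
  (forall e : R, 0 < e -> exists N, forall m n, (N <= m)%N -> (N <= n)%N ->
     forall t, Re (vanishing_ip (u m - u n) (u m - u n) t) <= e) ->
  exists x : vanishing, forall e : R, 0 < e -> exists N, forall n, (N <= n)%N ->
    forall t, Re (vanishing_ip (u n - x) (u n - x) t) <= e.
Proof.
move=> cu.
have cu' (e : R) : 0 < e -> exists N, forall i j, (N <= i)%N -> (N <= j)%N ->
    forall t, csq (v (u i) t - v (u j) t) <= e.
  move=> /cu[N hN]; exists N => i j Ni Nj t.
  by have := hN i j Ni Nj t; rewrite vanishing_ipE vanishingB.
have /choice[f hf] t := @complex_cauchy_limit R (fun k => v (u k) t) (fun e e0 =>
  let: ex_intro N hN := cu' e e0 in
  ex_intro _ N (fun i j Ni Nj => hN i j Ni Nj t)).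
have flim (e : R) : 0 < e -> exists N, forall k, (N <= k)%N ->
    forall t, csq (v (u k) t - f t) <= e.
  (* Chosen so that [2 r^2 <= 2 r <= e]. *)
  move=> e0; pose r := Num.min 1 (e / 2).
  have r0 : 0 < r by rewrite lt_min ltr01 divr_gt0.
  have r1 : r <= 1 by rewrite ge_min lexx.
  have re : r <= e / 2 by rewrite ge_min lexx orbT.
  have [N hN] := cu' _ (exprn_gt0 2 r0); exists N => k Nk t.
  by have := hf t r N r0 (fun i j Ni Nj => hN i j Ni Nj t) k Nk; nra.
have If : f \in vanishing_pred.
  apply/asboolP; split.
    apply: ccont_uniform_limit => e /flim[N hN]; exists (v (u N)).
      by have [] := vanishingP (u N).
    by move=> t; rewrite -csqN opprB; exact: hN.
  move=> t Ut; apply: csq_eq => e /flim[N /(_ N (leqnn N) t)].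
  by have [_ ->] := vanishingP (u N); rewrite // sub0r subr0 csqN.
exists (Vanishing If) => e /flim[N hN]; exists N => k Nk t.
by rewrite vanishing_ipE vanishingB; exact: hN.
Qed.

Definition vanishing_hmod : hmod R X.
Proof.
refine (@HMod R X vanishing vanishing_act vanishing_ip _ _ _ _ _ _ _ _ _ _
  vanishing_complete).
- move=> x y a ca; apply: vanishing_eqP => t.
  by rewrite vanishingD !vanishing_actE // vanishingD mulrDl.
- move=> x a b ca cb; apply: vanishing_eqP => t.
  by rewrite vanishingD !vanishing_actE ?mulrDr //; exact: ccontD.
- move=> x a b ca cb; apply: vanishing_eqP => t.
  by rewrite !vanishing_actE ?mulrA //; exact: ccontM.
- move=> x; apply: vanishing_eqP => t.
  by rewrite vanishing_actE ?mulr1 //; exact: ccont_cst.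
- move=> x y; have [cx _] := vanishingP x; have [cy _] := vanishingP y.
  by apply: ccontM => //; exact: ccontJ.
- by move=> x y z t; rewrite /vanishing_ip vanishingD mulrDr.
- by move=> x y a t ca; rewrite /vanishing_ip vanishing_actE // mulrA.
- by move=> x y t; rewrite /vanishing_ip rmorphM /= conjcK mulrC.
- by move=> x t; rewrite vanishing_ipE lecE /= eqxx csq_ge0.
move=> x x0; apply: vanishing_eqP => t; apply/csq_le0.
by have := congr1 (@complex.Re R) (x0 t); rewrite vanishing_ipE /= => ->.
Defined.

End VanishingModule.

(** * Countable generation and non-reflexivity of [C_0(U)] *)

Section NonReflexiveIdeal.
Variables (R : realType) (X : topologicalType).
Hypothesis cX : compact [set: X].
Local Notation C := (complex R).
Variable I : nat -> set (X -> C).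
Hypotheses (Icl : forall k, closed_ideal (I k))
  (Iorth : forall k l, k <> l -> orthogonal_ideals (I k) (I l))
  (Iprod : prod_canon_included I).
Variable g : nat -> X -> C.
Hypotheses (Ig : forall k, I k (g k)) (g1 : forall k t, csq (g k t) <= 1)
  (gt0 : forall k, exists t0, g k t0 = 1).

Let U : set X := [set t | exists k, g k t <> 0].
Let M := vanishing_hmod R U.

Lemma peak_vanishing k : g k \in vanishing_pred U.
Proof.
have [Ic _ _ _ _] := Icl k; apply/asboolP; split; first exact: Ic.
by move=> t Ut; apply: contrapT => gt; apply: Ut; exists k.
Qed.

Let gM k : M := Vanishing (peak_vanishing k).

Lemma ccont_peak k : ccont (g k).
Proof. by have [cg _] := vanishingP (Vanishing (peak_vanishing k)). Qed.

Lemma hsq_vanishing (x : M) t : hsq x t = csq (vanishing_val x t).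
Proof. by rewrite /hsq [hip _ _ _]vanishing_ipE. Qed.

(** With [G k] the sum of [|g i|^2] for [i < k], coefficients [g i^* x / max(G k, 1/(k+1))]
    reproduce [x] where [G k >= 1/(k+1)]. By compactness some [k] has [|x|^2 <= e] elsewhere. *)
Lemma vanishing_countably_generated : countably_generated M.
Proof.
exists gM => x e e0; have [cx x0] := vanishingP x.
pose G k t := \sum_(i < k) csq (g i t).
have G0 k t : 0 <= G k t by apply: sumr_ge0 => i _; exact: csq_ge0.
have cG k : rcont (G k).
  elim: k => [|k IH].
    rewrite (_ : G 0%N = fun _ => 0); first exact: rcontC.
    by apply/funext => t; rewrite /G big_ord0.
  rewrite (_ : G k.+1 = fun t => G k t + csq (g k t)).
    by apply: rcontD => //; apply: rcont_csq; exact: ccont_peak.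
  by apply/funext => t; rewrite /G big_ord_recr.
have [|k hk] := @compact_exhaust X cX
    (fun k t => csq (vanishing_val x t) <= e \/ k.+1%:R^-1 <= G k t).
  move=> t; have [xe|xe] := ltP (csq (vanishing_val x t)) e.
    exists ([set s | csq (vanishing_val x s) < e], setT).
      split; last exact: filterT.
      exact: (rcont_near_lt (rcont_csq cx) xe).
    by move=> [s k] /= [xs _]; left; exact: ltW.
  have [j gj] : U t.
    by apply: contrapT => /x0 xt; move: xe; rewrite xt csq0 leNgt e0.
  have c0 := csq_gt0 gj; have c2 : 0 < csq (g j t) / 2 by lra.
  have c21 : csq (g j t) / 2 < csq (g j t) by lra.
  have [N hN] := inv_succ_le c2.
  exists ([set s | csq (g j t) / 2 < csq (g j s)], [set k | (maxn N j.+1 <= k)%N]).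
    split; last by exists (maxn N j.+1).
    exact: (rcont_near_gt (rcont_csq (ccont_peak j)) c21).
  move=> [s k] /= [gs]; rewrite geq_max => /andP[Nk jk]; right.
  apply: le_trans (hN k Nk) _; apply: (le_trans (ltW gs)).
  rewrite /G (bigD1 (Ordinal jk)) //= lerDl.
  by apply: sumr_ge0 => i _; exact: csq_ge0.
have k0 : 0 < k.+1%:R^-1 :> R by rewrite invr_gt0 ltr0n.
pose m t := Num.max (G k t) k.+1%:R^-1.
have m0 t : 0 < m t by rewrite lt_max k0 orbT.
pose a i t := (g i t)^*%C * vanishing_val x t * (((m t)^-1)%:C)%C.
have ca i : ccont (a i).
  apply: ccontM; first by apply: ccontM => //; apply: ccontJ; exact: ccont_peak.
  apply: ccontC; apply: rcontV; first by move=> t; rewrite gt_eqF.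
  by apply: rcont_max => //; exact: rcontC.
exists k, a; split => // t; rewrite -/(hsq _ t) hsq_vanishing [_ (x - _) t]vanishingB.
have -> : vanishing_val (\sum_(i < k) hact (gM i) (a i)) t =
    vanishing_val x t * ((G k t / m t)%:C)%C.
  have -> : vanishing_val (\sum_(i < k) hact (gM i) (a i)) t =
      \sum_(i < k) vanishing_val (hact (gM i) (a i)) t.
    by apply: (big_morph (fun y : M => vanishing_val y t)) => // y z; exact: vanishingD.
  have -> : ((G k t / m t)%:C)%C = \sum_(i < k) ((csq (g i t) / m t)%:C)%C :> C.
    by rewrite /G mulr_suml rmorph_sum.
  rewrite mulr_sumr; apply: eq_bigr => i _; rewrite [LHS]vanishing_actE //= /a.
  transitivity (vanishing_val x t * ((g i t)^*%C * g i t * (((m t)^-1)%:C)%C)).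
    by ring.
  by rewrite mulJc -rmorphM.
have -> : vanishing_val x t - vanishing_val x t * ((G k t / m t)%:C)%C =
    vanishing_val x t * ((1 - G k t / m t)%:C)%C.
  by apply: eq_complexP; rewrite !ReImE; ring.
rewrite csqM csqC; have [xe|Gk] := hk t; last first.
  by rewrite /m max_l // divff ?gt_eqF ?subrr ?expr0n ?mulr0 ?ltW // (lt_le_trans k0).
apply: le_trans xe; rewrite ler_piMr ?csq_ge0 // expr_le1 //.
  by rewrite lerBlDr lerDl divr_ge0 // ltW.
by rewrite subr_ge0 ler_pdivrMr // mul1r le_max lexx.
Qed.

(** A representing [x] would equal [g k] wherever [g k] is nonzero. The compact set [|x| >= 1] in
    [U] would be covered by finitely many sets where some [g j] is nonzero, yet it contains the
    peaks of all [g k]. *)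
Lemma vanishing_not_reflexive : ~ cstar_reflexive M.
Proof.
move=> refl; pose S := \bigcup_k ideal_support (I k).
have gS k t : g k t <> 0 -> ideal_support (I k) t by move=> gt; exists (g k).
have /choice[phi phiE] (T : M -> X -> C) : exists f : X -> C, in_dual T ->
    [/\ ccont f, forall k t, ideal_support (I k) t -> f t = (T (gM k) t)^*%C &
        forall t, ~ closure S t -> f t = 0].
  have [dT|] := pselect (in_dual T); last by exists (fun _ => 0).
  have [K K0 TK] := in_dual_bound dT; have [cT _ _ _] := dT.
  (* [T (g k)] is dominated by [g k], hence its conjugate lies in the closed ideal [I k]. *)
  have lamI k : I k (fun t => (T (gM k) t)^*%C).
    apply: (closed_ideal_dominated (Icl k) (Ig k) _ K0).
      by apply: ccontJ; exact: cT.
    by move=> t; rewrite csqJ; have := TK (gM k) t; rewrite hsq_vanishing.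
  have [|f hf] := Iprod lamI; last by exists f.
  exists K => k t; rewrite csqJ; apply: (le_trans (TK _ _)).
  by rewrite hsq_vanishing ler_piMr //; exact: g1.
have phiP : in_bidual phi.
  split.
  - by move=> T /phiE[].
  - move=> T T' t dT dT'; have [c1 e1 z1] := phiE _ dT; have [c2 e2 z2] := phiE _ dT'.
    have [c3 e3 z3] := phiE _ (in_dual_add dT dT').
    apply: (dense_eq (f := phi (dual_add T T')) (g := fun t => phi T t + phi T' t) (U := S)) => //.
    + exact: ccontD.
    + move=> s [k _ Sk]; rewrite (e1 k) // (e2 k) // (e3 k) //.
      by rewrite /dual_add rmorphD.
    by move=> s Ss; rewrite z1 // z2 // z3 // addr0.
  - move=> T a t dT ca; have [c1 e1 z1] := phiE _ dT.
    have [c3 e3 z3] := phiE _ (in_dual_act cX dT ca).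
    apply: (dense_eq (f := phi (dual_act T a)) (g := fun t => phi T t * a t) (U := S)) => //.
    + exact: ccontM.
    + move=> s [k _ Sk]; rewrite (e1 k) // (e3 k) //.
      by rewrite /dual_act rmorphM /= conjcK mulrC.
    by move=> s Ss; rewrite z1 // z3 // mul0r.
  exists 1 => T c dT Tc t; rewrite mul1r; have c0 := opnle_ge0 t dT Tc.
  have [c1 e1 z1] := phiE _ dT.
  apply: (dense_le (h := fun t => csq (phi T t)) (U := S)).
  - exact: rcont_csq.
  - move=> s [k _ Sk]; rewrite (e1 k) // csqJ.
    apply: (le_trans (dual_pointwise _ _ dT Tc)).
    by rewrite hsq_vanishing ler_piMr //; exact: g1.
  by move=> s Ss; rewrite z1 // csq0.
have [x hx] := refl _ phiP.
(* Evaluating at [T = <g k, .>] gives [|g k|^2 = g k^* x]. *)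
have xg k t : g k t <> 0 -> vanishing_val x t = g k t.
  move=> gkt; have dg := in_dual_hip cX (gM k).
  have := hx _ dg t; have [_ e1 _] := phiE _ dg; rewrite (e1 k _ (gS _ _ gkt)).
  rewrite /canon_bidual => /(congr1 (@conjc R)); rewrite !conjcK.
  rewrite /hip /= /vanishing_ip /= => h; apply/esym.
  apply: (mulfI _ h); apply/eqP => g0; apply: gkt.
  by rewrite -[g k t]conjcK g0 conjc0.
have [cx x0] := vanishingP x.
have [|k hk] := @compact_exhaust X cX
    (fun k t => csq (vanishing_val x t) < 1 \/ exists2 j, (j < k)%N & g j t <> 0).
  move=> t; have [xe|xe] := ltP (csq (vanishing_val x t)) 1.
    exists ([set s | csq (vanishing_val x s) < 1], setT).
      split; last exact: filterT.
      exact: (rcont_near_lt (rcont_csq cx) xe).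
    by move=> [s k] /= [xs _]; left.
  have [j gj] : U t.
    by apply: contrapT => /x0 xt; move: xe; rewrite xt csq0 leNgt ltr01.
  exists ([set s | 0 < csq (g j s)], [set k | (j < k)%N]).
    split; last by exists j.+1.
    exact: (rcont_near_gt (rcont_csq (ccont_peak j)) (csq_gt0 gj)).
  move=> [s k] /= [gs jk]; right; exists j => // gs0.
  by move: gs; rewrite gs0 csq0 ltxx.
(* At the peak of [g k] one has [|x| = 1], while orthogonality makes every [g j] with [j < k]
   vanish. *)
have [t gkt] := gt0 k; have gkt0 : g k t <> 0 by rewrite gkt; apply/eqP/oner_neq0.
have [|[j jk gj]] := hk t.
  by rewrite (xg k) // gkt /csq /= expr1n expr0n addr0 ltxx.
have jk' : j <> k by move=> e; rewrite e ltnn in jk.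
by have := Iorth jk' (Ig j) (Ig k) t; rewrite gkt mulr1.
Qed.

End NonReflexiveIdeal.

Lemma ideals_nonreflexive (R : realType) (X : topologicalType)
    (I : nat -> set (X -> complex R)) : compact [set: X] ->
  (forall k, closed_ideal (I k)) -> (forall k, nonzero_ideal (I k)) ->
  (forall k l, k <> l -> orthogonal_ideals (I k) (I l)) ->
  prod_canon_included I ->
  exists2 M : hmod R X, countably_generated M & ~ cstar_reflexive M.
Proof.
move=> cX Icl Inz Iorth Iprod.
have /choice[g hg] k := closed_ideal_peak (Icl k) (Inz k).
have Ig k : I k (g k) by have [] := hg k.
have g1 k t : csq (g k t) <= 1 by have [_ /(_ t)] := hg k.
have gt0 k : exists t0, g k t0 = 1 by have [] := hg k.
exists (vanishing_hmod R [set t | exists k, g k t <> 0]).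
  exact: (vanishing_countably_generated cX Icl Ig).
exact: (vanishing_not_reflexive cX Icl Iorth Iprod Ig g1 gt0).
Qed.

Theorem theorem5p6 (R : realType) (X : topologicalType)
  (hX : hausdorff_space X) (cX : compact [set: X]) :
  (forall M : hmod R X, countably_generated M -> cstar_reflexive M) <->
  ~ (exists I : nat -> set (X -> complex R),
       [/\ forall k, closed_ideal (I k),
           forall k, nonzero_ideal (I k),
           forall k l, k <> l -> orthogonal_ideals (I k) (I l)
         & prod_canon_included I]).
Proof.
split.
  move=> refl [I [Icl Inz Iorth Iprod]].
  by have [M /refl rM] := ideals_nonreflexive cX Icl Inz Iorth Iprod.
move=> nI M cgM; apply: contrapT => nrM; apply: nI.
exact: (nonreflexive_ideals hX cX cgM nrM).
Qed.
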